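(* Let $U_1$ be a random variable with p.d.f. $f_1(u)=1$ for $0<u<1$ and zero otherwise, let $U_2$ be another random variable with p.d.f. $f_2(u)=2(1-u)$ for $0<u<1$ and zero otherwise, and let $X\overset{d}{=}\hat S_2/2$ have the hyperbolic sinh-distribution with p.d.f. $$f_X(x)=\frac{\pi[\pi x\coth(\pi x)-1]}{\sinh^2(\pi x)},\quad x\in\mathbb{R}.$$ Then the generalized Bernoulli function $B(s,a)$ has the integral representation, for $a\ge 1$, $s\in\mathbb{C}$, $$B(s,a)=\tfrac12E\big[(a-1+U_2+iX)^{s-1}\big]+(a-1)E\big[(U_1+iX)^{s-1}\big].$$ In particular, when $a=1$, the Bernoulli function $B(s)=B(s,1)$ satisfies $$B(s)=\tfrac12E\big[(U_2+iX)^{s-1}\big],\quad s\in\mathbb{C}.$$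
   Context: The generalized Bernoulli function is defined for $s\in\mathbb{C}$, $a>\frac12$ by $$B(s,a)=2\pi\int_{-\infty}^{\infty}\frac{(a-\frac12+ix)^s}{(e^{\pi x}+e^{-\pi x})^2}\,dx,$$ and it satisfies $B(s,a)=-s\,\zeta(1-s,a)$, where $\zeta(\cdot,a)$ is the Hurwitz zeta function, given by $\zeta(s,a)=\sum_{n=0}^\infty (n+a)^{-s}$ for $\mathrm{Re}(s)>1$, $a>0$, and extended to all complex $s\neq1$. $\hat S_2$ denotes a random variable with characteristic function $E(e^{i\theta\hat S_2})=(\theta/\sinh\theta)^2$, $\theta\in\mathbb{R}$; thus $E(e^{i\theta X})=\big(\frac{\theta/2}{\sinh(\theta/2)}\big)^2$. $X$ is taken independent of $U_1$ and of $U_2$. The identity is understood for all $s\in\mathbb{C}$ by analytic continuation.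
   Formalization: The second summand is corrected to (a-1)E[(a-1+U_1+iX)^{s-1}]: as printed, without the shift a-1, the identity fails, e.g. at s=2, a=2, where B(2,2)=13/6 but the printed right-hand side is 7/6. *)

(* Defs.v *)
From HB Require Import structures.
From mathcomp Require Import all_boot all_order all_algebra.
From mathcomp Require Export complex.
From mathcomp Require Export all_classical all_reals all_analysis.

Set Implicit Arguments.
Unset Strict Implicit.
Unset Printing Implicit Defensive.

Import Order.TTheory GRing.Theory Num.Theory.
Import numFieldNormedType.Exports.

Local Open Scope classical_set_scope.
Local Open Scope complex_scope.
Local Open Scope ring_scope.

Section HyperbolicFunctions.
Variable R : realType.
Implicit Types x : R.

Definition sinh x : R := (expR x - expR (- x)) / 2.

Definition cosh x : R := (expR x + expR (- x)) / 2.

Definition coth x : R := cosh x / sinh x.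

End HyperbolicFunctions.

Section ComplexPower.
Variable R : realType.
Implicit Types z s : R[i].

Definition expC z : R[i] :=
  (expR (complex.Re z) * cos (complex.Im z)) +i*
  (expR (complex.Re z) * sin (complex.Im z)).

(* Principal argument, with values in ]-pi, pi] for z != 0. *)
Definition argC z : R :=
  if 0 <= complex.Im z then acos (complex.Re z / ComplexField.Normc.normc z)
  else - acos (complex.Re z / ComplexField.Normc.normc z).

Definition logC z : R[i] := ln (ComplexField.Normc.normc z) +i* argC z.

(* Principal branch of z ^ s for z != 0; the value at z = 0 is irrelevant
   below, where the base has positive real part (almost surely). *)
Definition powC z s : R[i] := expC (s * logC z).

End ComplexPower.

Section ComplexIntegral.
Context (R : realType) (d : measure_display) (T : measurableType d).
Variable mu : {measure set T -> \bar R}.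
Implicit Types f : T -> R[i].

Definition integrableC f : Prop :=
  mu.-integrable setT (fun t => (complex.Re (f t))%:E) /\
  mu.-integrable setT (fun t => (complex.Im (f t))%:E).

Definition integralC f : R[i] :=
  (\int[mu]_t complex.Re (f t)) +i* (\int[mu]_t complex.Im (f t)).

End ComplexIntegral.

Section RandomVariables.
Context (R : realType) (d : measure_display) (T : measurableType d).
Variable P : probability T R.

Definition expectationC (Z : T -> R[i]) : R[i] := integralC P Z.

Definition has_pdf (X : T -> R) (f : R -> R) : Prop :=
  forall A : set R, measurable A ->
    P (X @^-1` A) = (\int[lebesgue_measure]_(x in A) (f x)%:E)%E.

Definition independent (X Y : T -> R) : Prop :=
  forall A B : set R, measurable A -> measurable B ->
    P (X @^-1` A `&` Y @^-1` B) = (P (X @^-1` A) * P (Y @^-1` B))%E.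

Definition charfun (X : T -> R) (theta : R) : R[i] :=
  expectationC (fun t => expC (0 +i* (theta * X t))).

End RandomVariables.

Definition eq_in_distribution (R : realType)
    (d : measure_display) (T : measurableType d) (P : probability T R)
    (d' : measure_display) (T' : measurableType d') (P' : probability T' R)
    (X : T -> R) (Y : T' -> R) : Prop :=
  forall A : set R, measurable A -> P (X @^-1` A) = P' (Y @^-1` A).

Section Densities.
Variable R : realType.

Definition pdf_U1 (u : R) : R := if 0 < u < 1 then 1 else 0.

Definition pdf_U2 (u : R) : R := if 0 < u < 1 then 2 * (1 - u) else 0.

(* At x = 0 the formula reads _ / 0 = 0 instead of the limit pi / 3; a single
   point does not affect the distribution. *)
Definition pdf_X (x : R) : R :=
  pi * (pi * x * coth (pi * x) - 1) / sinh (pi * x) ^+ 2.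

(* (theta / sinh theta) ^ 2, extended by continuity at 0. *)
Definition charfun_S2 (theta : R) : R :=
  if theta == 0 then 1 else (theta / sinh theta) ^+ 2.

End Densities.

Section Bernoulli.
Variable R : realType.

(* Meaningful for 1/2 < a. *)
Definition gen_bernoulli (s : R[i]) (a : R) : R[i] :=
  (2 * pi)%:C * integralC lebesgue_measure (fun x : R =>
    powC ((a - 2^-1) +i* x) s / ((expR (pi * x) + expR (- (pi * x))) ^+ 2)%:C).

Definition bernoulli (s : R[i]) : R[i] := gen_bernoulli s 1.

Definition entire (F : R[i] -> R[i]) : Prop :=
  forall s : R[i], derivable (F : R[i]^o -> R[i]^o) s 1.

(* F is the analytic continuation to the whole plane of f, given on D; it is
   unique as soon as D has an accumulation point. *)
Definition entire_continuation (D : set R[i]) (f F : R[i] -> R[i]) : Prop :=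
  entire F /\ (forall s, D s -> F s = f s).

End Bernoulli.

(* Main.v *)
Require Import Defs.
From HB Require Import structures.
From mathcomp Require Import all_boot all_order all_algebra.
From mathcomp Require Import complex.
From mathcomp Require Import all_classical all_reals all_analysis.
From mathcomp Require Import ring lra.
From mathcomp Require Import measurable_realfun.

(** Put c = a - 1/2.  The density of X is the restriction to the real line of
    the kernel k(z) = pi (pi z coth (pi z) - 1) / sinh^2 (pi z), which is half
    the second derivative of z coth (pi z) and is holomorphic on |Im z| < 1
    once its removable singularity at 0 is filled.

    The two expectations are one double integral.  By independence the law of
    (U, X) is a product, and on 0 < u < 1 half the density of U2 plus a - 1
    times that of U1 is a - u.  So the right-hand side of the identity is the
    integral over 0 < u < 1 of (a - u) times the integral over the real x of
    k(x) (a - 1 + u + i x)^(s - 1).  For each fixed u the line of integration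
    is shifted until the base of the power lies on the line Re = c, whatever
    u is (kernel_shift); the power becomes (c + i y)^(s - 1), and u survives
    only in the argument y + i (u - 1/2) of the kernel.  After an exchange of
    integrals the inner integral over u of (a - u) k(y + i (u - 1/2)) is
    elementary, because z coth (pi z) is a second antiderivative of 2 k and
    coth turns into tanh at the end points of the segment, which are shifted
    by i/2 and -i/2.  It equals 2 pi (c + i y) / (e^(pi y) + e^(-pi y))^2
    (inner_integral), and the remaining factor c + i y raises the exponent
    from s - 1 to s: what is left is the integral that defines B(s, a)
    (weighted_shift_integral, mixture_integral).

    The argument applies to each exponent s for which the expectations
    converge.  The entire function that continues them is B(., a) itself,
    whose integral may be differentiated in s under the integral sign
    (entire_gen_bernoulli).

    Three estimates make the exchanges of limits legitimate.  The kernel is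
    bounded by C e^(-|Re z|) uniformly on |Im z| <= 1/2, up to the removable
    singularity (normc_kerX_le).  On a vertical strip in the right half-plane
    |z^s| <= C e^(|Im z| / 2), so that the product still decays
    (normc_powH_bound).  For a = 1 the power is singular at u = x = 0, and
    |u + i x|^2 >= 2 u |x| splits that singularity into a product of
    integrable powers of u and |x| exactly when Re s > -1
    (powH_singularity_bound). *)


Set Implicit Arguments.
Unset Strict Implicit.
Unset Printing Implicit Defensive.

Import Order.TTheory GRing.Theory Num.Theory.
Import numFieldNormedType.Exports.
Import ComplexField.Normc.

Local Open Scope classical_set_scope.
Local Open Scope complex_scope.
Local Open Scope ring_scope.

(** * Complex numbers and derivatives of complex-valued curves *)

Section ComplexNumbers.
Variable R : realType.
Implicit Types (x y t : R) (z w : R[i]).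

Lemma cReD z w : complex.Re (z + w) = complex.Re z + complex.Re w.
Proof. by case: z w => [a b] [c d]. Qed.

Lemma cImD z w : complex.Im (z + w) = complex.Im z + complex.Im w.
Proof. by case: z w => [a b] [c d]. Qed.

Lemma cReN z : complex.Re (- z) = - complex.Re z.
Proof. by case: z. Qed.

Lemma cImN z : complex.Im (- z) = - complex.Im z.
Proof. by case: z. Qed.

Lemma cReM z w : complex.Re (z * w) =
  complex.Re z * complex.Re w - complex.Im z * complex.Im w.
Proof. by case: z w => [a b] [c d]. Qed.

Lemma cImM z w : complex.Im (z * w) =
  complex.Re z * complex.Im w + complex.Im z * complex.Re w.
Proof. by case: z w => [a b] [c d]. Qed.

Lemma eq_cplx z w : complex.Re z = complex.Re w ->
  complex.Im z = complex.Im w -> z = w.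
Proof. by case: z w => [a b] [c d] /= -> ->. Qed.

Lemma cplxE x y : x +i* y = x%:C + 'i%C * y%:C :> R[i].
Proof. by rewrite [LHS]complexE. Qed.

Lemma normc_ge0 z : 0 <= normc z.
Proof. by case: z => a b; rewrite sqrtr_ge0. Qed.

Lemma normcR x : normc x%:C = `|x|.
Proof. by rewrite /= expr0n addr0 sqrtr_sqr. Qed.

Lemma normci : normc ('i%C : R[i]) = 1.
Proof. by rewrite /= expr0n add0r expr1n sqrtr1. Qed.

Lemma normc_gt0 z : z != 0 -> 0 < normc z.
Proof.
move=> z0; rewrite lt_neqAle normc_ge0 andbT eq_sym.
by apply: contra z0 => /eqP/eq0_normc ->.
Qed.

Lemma normc_sqr z : normc z ^+ 2 = complex.Re z ^+ 2 + complex.Im z ^+ 2.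
Proof. by case: z => a b; rewrite sqr_sqrtr ?addr_ge0 ?sqr_ge0. Qed.

Lemma normc_Re z : `|complex.Re z| <= normc z.
Proof.
case: z => a b /=; rewrite -sqrtr_sqr ler_wsqrtr//.
by rewrite lerDl sqr_ge0.
Qed.

Lemma normc_Im z : `|complex.Im z| <= normc z.
Proof.
case: z => a b /=; rewrite -sqrtr_sqr ler_wsqrtr//.
by rewrite lerDr sqr_ge0.
Qed.

Lemma normc_leD z w : normc (z + w) <= normc z + normc w.
Proof. exact: (@le_normcD R z w). Qed.

Lemma normc_opp z : normc (- z) = normc z.
Proof. exact: (@normcN R z). Qed.

Lemma normc_leB z w : normc (z - w) <= normc z + normc w.
Proof. by rewrite -(normc_opp w) normc_leD. Qed.

Lemma normcX z n : normc (z ^+ n) = normc z ^+ n.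
Proof.
elim: n => [|n ih]; first by rewrite !expr0 normc1.
by rewrite !exprS normcM ih.
Qed.

Lemma normc_le_ReIm z : normc z <= `|complex.Re z| + `|complex.Im z|.
Proof.
rewrite {1}(complexE z) (le_trans (normc_leD _ _))//.
by rewrite normcM normci mul1r !normcR.
Qed.

Lemma expCD z w : expC (z + w) = expC z * expC w.
Proof.
apply: eq_cplx; rewrite /expC ?cReM ?cImM/= !(cReD, cImD) expRD ?cosD ?sinD; ring.
Qed.

Lemma normc_expC z : normc (expC z) = expR (complex.Re z).
Proof.
rewrite /expC /= !exprMn -mulrDr cos2Dsin2 mulr1 sqrtr_sqr.
by rewrite ger0_norm ?expR_ge0.
Qed.

Lemma expC0 : expC 0 = 1 :> R[i].
Proof. by rewrite /expC /= expR0 cos0 sin0 mulr1 mulr0. Qed.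

Lemma expCR x : expC x%:C = (expR x)%:C.
Proof. by rewrite /expC /= cos0 sin0 mulr1 mulr0. Qed.

End ComplexNumbers.

Section ComplexDerivative.
Variable R : realType.
Implicit Types (f g : R -> R[i]) (x t : R) (z w l : R[i]).

(** Only derivatives along a real parameter are needed: a holomorphic function
    enters through its curves t |-> F (z t), for which each rule below is the
    chain rule with the complex derivative of F. *)
Definition cderiv f x l : Prop :=
  is_derive x 1 (fun t => complex.Re (f t)) (complex.Re l) /\
  is_derive x 1 (fun t => complex.Im (f t)) (complex.Im l).

Lemma cderiv_eq f x l l' : cderiv f x l -> l = l' -> cderiv f x l'.
Proof. by move=> ? <-. Qed.

Lemma cderiv_ext f g x l : (forall t, f t = g t) -> cderiv f x l -> cderiv g x l.
Proof. by move=> /funext ->. Qed.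

Lemma cderiv_cst z x : cderiv (fun=> z) x 0.
Proof. by split; exact: is_derive_cst. Qed.

Lemma cderiv_id x : cderiv (fun t => t%:C) x 1.
Proof. by split => /=; [exact: is_derive_id | exact: is_derive_cst]. Qed.

Lemma cderiv_R (f : R -> R) x (l : R) :
  is_derive x 1 f l -> cderiv (fun t => (f t)%:C) x l%:C.
Proof. by move=> df; split => /=; [exact: df | exact: is_derive_cst]. Qed.

Lemma cderivD f g x l m : cderiv f x l -> cderiv g x m ->
  cderiv (fun t => f t + g t) x (l + m).
Proof.
move=> [f1 f2] [g1 g2]; split.
- under eq_fun do rewrite cReD; rewrite cReD; exact: is_deriveD.
- under eq_fun do rewrite cImD; rewrite cImD; exact: is_deriveD.
Qed.

Lemma cderivN f x l : cderiv f x l -> cderiv (fun t => - f t) x (- l).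
Proof.
move=> [f1 f2]; split.
- under eq_fun do rewrite cReN; rewrite cReN; exact: is_deriveN.
- under eq_fun do rewrite cImN; rewrite cImN; exact: is_deriveN.
Qed.

Lemma cderivB f g x l m : cderiv f x l -> cderiv g x m ->
  cderiv (fun t => f t - g t) x (l - m).
Proof. by move=> df dg; apply: cderivD => //; exact: cderivN. Qed.

Lemma cderivM f g x l m : cderiv f x l -> cderiv g x m ->
  cderiv (fun t => f t * g t) x (l * g x + f x * m).
Proof.
move=> [f1 f2] [g1 g2]; split.
- under eq_fun do rewrite cReM.
  apply: is_derive_eq.
  rewrite !(cReD, cReM) /GRing.scale/=; ring.
- under eq_fun do rewrite cImM.
  apply: is_derive_eq.
  rewrite !(cImD, cImM) /GRing.scale/=; ring.
Qed.

Lemma cderivMl z f x l : cderiv f x l -> cderiv (fun t => z * f t) x (z * l).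
Proof.
by move=> /(cderivM (cderiv_cst z x)) d; apply: cderiv_eq d _; rewrite mul0r add0r.
Qed.

Lemma cderiv_expC f x l : cderiv f x l ->
  cderiv (fun t => expC (f t)) x (l * expC (f x)).
Proof.
move=> [f1 f2]; split => /=.
- have d1 := @is_derive1_comp R expR (fun t => complex.Re (f t)) _ _ _ _ f1.
  have d2 := @is_derive1_comp R cos (fun t => complex.Im (f t)) _ _ _ _ f2.
  apply: is_derive_eq.
  rewrite !cReM /GRing.scale/=; ring.
- have d1 := @is_derive1_comp R expR (fun t => complex.Re (f t)) _ _ _ _ f1.
  have d2 := @is_derive1_comp R sin (fun t => complex.Im (f t)) _ _ _ _ f2.
  apply: is_derive_eq.
  rewrite !cImM /GRing.scale/=; ring.
Qed.

Lemma cderivV f x l : f x != 0 -> cderiv f x l ->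
  cderiv (fun t => (f t)^-1) x (- l / f x ^+ 2).
Proof.
move=> fx0 [f1 f2].
have n0 : complex.Re (f x) ^+ 2 + complex.Im (f x) ^+ 2 != 0.
  by rewrite -normc_sqr sqrf_eq0 gt_eqF// normc_gt0.
have ReV z : complex.Re z^-1 =
    complex.Re z / (complex.Re z ^+ 2 + complex.Im z ^+ 2) by case: z.
have ImV z : complex.Im z^-1 =
    - complex.Im z / (complex.Re z ^+ 2 + complex.Im z ^+ 2).
  by case: z => a b; rewrite mulNr.
have Nd : is_derive x 1 (fun t => (complex.Re (f t) ^+ 2 + complex.Im (f t) ^+ 2)^-1)
   (- (2 * complex.Re (f x) * complex.Re l + 2 * complex.Im (f x) * complex.Im l) /
     (complex.Re (f x) ^+ 2 + complex.Im (f x) ^+ 2) ^+ 2).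
  have d : is_derive x 1 (fun t => complex.Re (f t) ^+ 2 + complex.Im (f t) ^+ 2)
     (2 * complex.Re (f x) * complex.Re l + 2 * complex.Im (f x) * complex.Im l).
    apply: is_derive_eq; rewrite /GRing.scale/=; ring.
  have h := @is_deriveV R
    (fun t => complex.Re (f t) ^+ 2 + complex.Im (f t) ^+ 2) x _ 1 n0 d.
  by apply: is_derive_eq; rewrite /GRing.scale/=; field.
have -> : - l / f x ^+ 2 = - (l * ((f x)^-1 * (f x)^-1)) by field.
split.
- under eq_fun do rewrite ReV.
  apply: is_derive_eq.
  rewrite !(cReN, cReM, cImM) !ReV !ImV /GRing.scale/=.
  by field.
- under eq_fun do rewrite ImV.
  apply: is_derive_eq.
  rewrite !(cImN, cReM, cImM) !ReV !ImV /GRing.scale/=.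
  by field.
Qed.

End ComplexDerivative.

(** * Powers on the right half-plane *)

Section ComplexPowerHalfPlane.
Variable R : realType.
Implicit Types (x y t : R) (z w s l : R[i]).

(** The principal logarithm on Re z > 0.  Unlike an argument defined through
    acos, the formula with atan has no case distinction on the sign of Im z and
    is differentiable across the positive axis. *)
Definition logH z : R[i] :=
  (ln (complex.Re z ^+ 2 + complex.Im z ^+ 2) / 2) +i*
  atan (complex.Im z / complex.Re z).

Definition powH z s : R[i] := expC (s * logH z).

Lemma normc_sqr_gt0 z : 0 < complex.Re z ->
  0 < complex.Re z ^+ 2 + complex.Im z ^+ 2.
Proof. by move=> z0; rewrite ltr_wpDr ?sqr_ge0// exprn_gt0. Qed.

(** Both sides lie in the range where cos is injective up to sign, and have
    the same cosine; the sign of Im z decides between v and - v. *)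
Lemma argC_atan z : 0 < complex.Re z ->
  argC z = atan (complex.Im z / complex.Re z).
Proof.
case: z => a b /= a0; rewrite /argC/=.
set v := atan (b / a).
have cosv : cos v = a / Num.sqrt (a ^+ 2 + b ^+ 2).
  rewrite cos_atan.
  have -> : a ^+ 2 + b ^+ 2 = a ^+ 2 * (1 + (b / a) ^+ 2).
    by field; rewrite gt_eqF.
  rewrite sqrtrM ?sqr_ge0// sqrtr_sqr gtr0_norm// invfM mulrA divff ?mul1r//.
  by rewrite gt_eqF.
have lv : - (pi / 2) < v := atan_gtNpi2 _.
have vl : v < pi / 2 := atan_ltpi2 _.
have pi0 : 0 < pi :> R := pi_gt0 R.
have pi2 : pi / 2 <= pi :> R by rewrite ler_pdivrMr// mulr2n; lra.
case: ifPn => [b0|]; rewrite -cosv.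
  rewrite cosK// in_itv/= (ltW (lt_le_trans vl _))// andbT.
  by rewrite -(atan0 R) le_atan// divr_ge0// ltW.
rewrite -ltNge => b0; rewrite cosKN ?opprK//.
rewrite (@le_trans _ _ (- (pi / 2))) ?lerN2//= ?(ltW lv)//.
by rewrite -(atan0 R) le_atan// mulr_le0_ge0 ?invr_ge0// ltW.
Qed.

Lemma logC_logH z : 0 < complex.Re z -> logC z = logH z.
Proof.
move=> z0; rewrite /logC argC_atan// /logH; congr (_ +i* _).
have n0 : 0 < normc z.
  by apply: normc_gt0; apply: contraTneq z0 => ->; rewrite /= ltxx.
by rewrite -normc_sqr lnXn// mulr2n; field.
Qed.

Lemma powC_powH z s : 0 < complex.Re z -> powC z s = powH z s.
Proof. by move=> z0; rewrite /powC logC_logH. Qed.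

Lemma cderiv_logH (f : R -> R[i]) x l : 0 < complex.Re (f x) ->
  cderiv f x l -> cderiv (fun t => logH (f t)) x (l / f x).
Proof.
move=> fx0 [f1 f2].
have n0 := normc_sqr_gt0 fx0.
have ReV z : complex.Re z^-1 =
    complex.Re z / (complex.Re z ^+ 2 + complex.Im z ^+ 2) by case: z.
have ImV z : complex.Im z^-1 =
    - complex.Im z / (complex.Re z ^+ 2 + complex.Im z ^+ 2).
  by case: z => a b; rewrite mulNr.
split => /=.
- have d : is_derive x 1 (fun t => complex.Re (f t) ^+ 2 + complex.Im (f t) ^+ 2)
     (2 * complex.Re (f x) * complex.Re l + 2 * complex.Im (f x) * complex.Im l).
    apply: is_derive_eq; rewrite /GRing.scale/=; ring.
  have h := @is_derive1_comp R (@ln R) _ x _ _ (is_derive1_ln n0) d.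
  apply: is_derive_eq; rewrite cReM ReV ImV /GRing.scale/=.
  by field; rewrite gt_eqF.
- have fx1 : complex.Re (f x) != 0 by rewrite gt_eqF.
  have h := @realfun.is_deriveV R (fun t => complex.Re (f t)) x _ 1 fx1 f1.
  have h2 : is_derive x 1 (fun t => complex.Im (f t) / complex.Re (f t))
     ((complex.Im l * complex.Re (f x) - complex.Im (f x) * complex.Re l) /
        complex.Re (f x) ^+ 2).
    by apply: is_derive_eq; rewrite /GRing.scale/=; field.
  have h3 := @is_derive1_comp R (@atan R) _ x _ _ (is_derive1_atan _) h2.
  apply: is_derive_eq; rewrite cImM ReV ImV /GRing.scale/=.
  have n1 : 1 + (complex.Im (f x) / complex.Re (f x)) ^+ 2 != 0.
    by rewrite gt_eqF// ltr_pwDl ?sqr_ge0.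
  by field; rewrite fx1 gt_eqF//= addrC.
Qed.

Lemma cderiv_powH (f : R -> R[i]) s x l : 0 < complex.Re (f x) ->
  cderiv f x l ->
  cderiv (fun t => powH (f t) s) x (s * (l / f x) * powH (f x) s).
Proof. by move=> fx0 df; apply/cderiv_expC/cderivMl/cderiv_logH. Qed.

(** Equivalent to e^(logH z) = z. *)
Lemma powH_mul z s : 0 < complex.Re z -> z * powH z (s - 1) = powH z s.
Proof.
move=> z0; have E : s * logH z = logH z + (s - 1) * logH z by ring.
rewrite /powH E expCD; congr (_ * _).
rewrite /expC /logH /=.
have n0 := normc_sqr_gt0 z0.
set v := atan _.
have -> : expR (ln (complex.Re z ^+ 2 + complex.Im z ^+ 2) / 2) = normc z.
  rewrite -normc_sqr lnXn ?mulr2n.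
    rewrite -[_ + _]/(ln _ *+ 2) -mulr_natr mulfK ?pnatr_eq0// lnK//.
    by rewrite posrE -(@ltr_pXn2r _ 2) ?nnegrE ?normc_ge0// normc_sqr expr0n.
  by rewrite -(@ltr_pXn2r _ 2) ?nnegrE ?normc_ge0// normc_sqr expr0n.
have nz : normc z = complex.Re z * Num.sqrt (1 + (complex.Im z / complex.Re z) ^+ 2).
  rewrite -{1}(gtr0_norm z0) -sqrtr_sqr -sqrtrM ?sqr_ge0//.
  rewrite [LHS]/normc; case: z z0 {E n0 v} => a b /= a0; congr Num.sqrt.
  by field; rewrite gt_eqF.
have sq0 : Num.sqrt (1 + (complex.Im z / complex.Re z) ^+ 2) != 0.
  by rewrite gt_eqF// sqrtr_gt0 ltr_pwDl ?sqr_ge0.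
have cosv : cos v != 0.
  by rewrite cos_atan invr_eq0.
have cv : normc z * cos v = complex.Re z.
  by rewrite nz cos_atan mulfK.
have sv : normc z * sin v = complex.Im z.
  have -> : sin v = tan v * cos v by rewrite /tan mulfVK.
  by rewrite atanK mulrCA cv mulfVK// gt_eqF.
by rewrite cv sv; apply: eq_cplx.
Qed.

Lemma atan_bound x : `|atan x| <= pi.
Proof.
have pi0 : 0 < pi :> R := pi_gt0 R.
have := atan_gtNpi2 x; have := atan_ltpi2 x => h1 h2.
have pi2 : pi / 2 <= pi :> R by rewrite ler_pdivrMr// mulr2n; lra.
rewrite ler_norml; apply/andP; split; lra.
Qed.

Lemma normc_powH_le z s : normc (powH z s) <=
  expR (pi * `|complex.Im s|) *
  expR (complex.Re s * (ln (complex.Re z ^+ 2 + complex.Im z ^+ 2) / 2)).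
Proof.
rewrite normc_expC -expRD ler_expR cReM /= addrC lerD2r.
rewrite (le_trans (ler_norm _))// normrN normrM mulrC ler_wpM2r//.
exact: atan_bound.
Qed.

(** ln y <= e y - ln e for every e > 0: on a strip ln |z| grows more slowly
    than any multiple of |Im z|, so every power of |z| is dominated by
    e^(|Im z| / 2), while Re z >= v keeps ln |z| bounded below. *)
Lemma log_modulus_bound (K v A : R) : 0 <= K -> 0 < v ->
  exists2 C, 0 < C & forall z, v <= complex.Re z <= A ->
  expR (K * `|ln (complex.Re z ^+ 2 + complex.Im z ^+ 2) / 2|) <=
  C * expR (`|complex.Im z| / 2).
Proof.
move=> K0 v0.
(* this slope makes K * e <= 1/2, the exponent that is aimed at *)
pose e := (2 * K + 2)^-1.
have e0 : 0 < e by rewrite invr_gt0; lra.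
have Ke : K * e <= 2^-1.
  by rewrite -ler_pdivlMr// invrK; lra.
pose D := `|ln v| + e * `|A| + `|ln e|.
exists (expR (K * D)); first exact: expR_gt0.
move=> z /andP[vz zA].
have z0 := lt_le_trans v0 vz.
rewrite -expRD ler_expR.
suff h : `|ln (complex.Re z ^+ 2 + complex.Im z ^+ 2) / 2| <= D + e * `|complex.Im z|.
  rewrite (le_trans (ler_wpM2l K0 h))// mulrDr lerD2l mulrA mulrC ler_wpM2l//.
set L := _ / 2.
have lo : ln v <= L.
  rewrite /L ler_pdivlMr// mulr_natr -lnXn//.
  rewrite ler_ln ?posrE ?exprn_gt0 ?normc_sqr_gt0//.
  by rewrite ler_wpDr ?sqr_ge0// ler_sqr ?nnegrE// ?ltW.
have A0 : 0 < A by rewrite (lt_le_trans v0)// (le_trans vz).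
have B0 : 0 < A + `|complex.Im z| by rewrite ltr_pwDl.
have hi : L <= ln (A + `|complex.Im z|).
  rewrite /L ler_pdivrMr// mulr_natr -lnXn//.
  rewrite ler_ln ?posrE ?exprn_gt0 ?normc_sqr_gt0//.
  rewrite sqrrD real_normK ?num_real// lerD2r.
  rewrite ler_wpDr ?mulrn_wge0 ?mulr_ge0 ?(ltW A0)//.
  by rewrite ler_sqr ?nnegrE// ?ltW.
have hi2 : ln (A + `|complex.Im z|) <= e * (A + `|complex.Im z|) - ln e.
  rewrite lerBrDl -lnM ?posrE// ltW// ln_sublinear// mulr_gt0//.
have h1 : - ln v <= `|ln v| by rewrite -normrN ler_norm.
have h2 : - ln e <= `|ln e| by rewrite -normrN ler_norm.
have h3 : e * `|A| = e * A by rewrite gtr0_norm.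
have h4 : 0 <= e * A by rewrite mulr_ge0 ?ltW.
have h5 : 0 <= e * `|complex.Im z| by rewrite mulr_ge0 ?(ltW e0).
have h6 : 0 <= `|ln e| by [].
have h7 : 0 <= `|ln v| by [].
rewrite mulrDr in hi2.
rewrite /D h3 ler_norml; apply/andP; split.
  by clear -h1 h4 h5 h6 h7 lo; lra.
by clear -h2 h4 h5 h6 h7 hi hi2; lra.
Qed.

(** The power grows at most half as fast as the kernel decays, so their
    product stays integrable on vertical lines. *)
Lemma normc_powH_bound s (v A : R) : 0 < v ->
  exists2 C, 0 < C & forall z, v <= complex.Re z <= A ->
  normc (powH z s) <= C * expR (`|complex.Im z| / 2).
Proof.
move=> v0.
have [C C0 hC] := @log_modulus_bound `|complex.Re s| v A (normr_ge0 _) v0.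
exists (expR (pi * `|complex.Im s|) * C); first by rewrite mulr_gt0 ?expR_gt0.
move=> z zvA; rewrite (le_trans (normc_powH_le _ _))// -mulrA.
rewrite ler_wpM2l ?expR_ge0// (le_trans _ (hC _ zvA))// ler_expR -normrM.
exact: ler_norm.
Qed.

End ComplexPowerHalfPlane.

(** * The hyperbolic kernel *)

Section HyperbolicKernel.
Variable R : realType.
Implicit Types (x y t : R) (z w q l : R[i]).

Definition csinh z : R[i] := (expC z - expC (- z)) / 2%:R.
Definition ccosh z : R[i] := (expC z + expC (- z)) / 2%:R.

(** Half the second derivative of z coth (pi z), whose poles nearest to the
    real line are i and - i.  The singularity at 0 is removable, but the value
    of this formula there is 0 instead of the limit pi / 3. *)
Definition kerX z : R[i] :=
  pi%:C * (pi%:C * z * (ccosh (pi%:C * z) / csinh (pi%:C * z)) - 1) /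
  csinh (pi%:C * z) ^+ 2.

(** The complex derivative of kerX, reduced with cosh^2 - sinh^2 = 1. *)
Definition dkerX z : R[i] :=
  let S := (csinh (pi%:C * z))^-1 in let Ct := ccosh (pi%:C * z) * S in
  3%:R * pi%:C ^+ 2 * Ct * S ^+ 2 - pi%:C ^+ 3 * z * S ^+ 4
  - 2%:R * pi%:C ^+ 3 * z * Ct ^+ 2 * S ^+ 2.

Lemma natC n : n%:R = (n%:R)%:C :> R[i].
Proof. by rewrite rmorph_nat. Qed.

Lemma csinhR x : csinh x%:C = (sinh x)%:C.
Proof.
by rewrite /csinh -rmorphN !expCR natC -rmorphB -fmorphV -rmorphM.
Qed.

Lemma ccoshR x : ccosh x%:C = (cosh x)%:C.
Proof.
by rewrite /ccosh -rmorphN !expCR natC -rmorphD -fmorphV -rmorphM.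
Qed.

Lemma kerXR x : kerX x%:C = (pdf_X x)%:C.
Proof.
by rewrite /kerX -!rmorphM csinhR ccoshR -fmorphV -rmorphM -(rmorph1 (real_complex R))
  -rmorphM -rmorphB -rmorphM -rmorphXn -fmorphV -rmorphM.
Qed.

Lemma csinhN z : csinh (- z) = - csinh z.
Proof. by rewrite /csinh opprK -mulNr opprB. Qed.

Lemma cderiv_csinh (f : R -> R[i]) x l : cderiv f x l ->
  cderiv (fun t => csinh (f t)) x (l * ccosh (f x)).
Proof.
move=> df; apply: (@cderiv_ext _ (fun t => 2%:R^-1 * (expC (f t) - expC (- f t)))).
  by move=> t; rewrite /csinh mulrC.
apply: cderiv_eq.
  exact: cderivMl (cderivB (cderiv_expC df) (cderiv_expC (cderivN df))).
rewrite /ccosh; ring.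
Qed.

Lemma cderiv_ccosh (f : R -> R[i]) x l : cderiv f x l ->
  cderiv (fun t => ccosh (f t)) x (l * csinh (f x)).
Proof.
move=> df; apply: (@cderiv_ext _ (fun t => 2%:R^-1 * (expC (f t) + expC (- f t)))).
  by move=> t; rewrite /ccosh mulrC.
apply: cderiv_eq.
  exact: cderivMl (cderivD (cderiv_expC df) (cderiv_expC (cderivN df))).
rewrite /csinh; ring.
Qed.

Lemma cosh2_sinh2 z : ccosh z ^+ 2 - csinh z ^+ 2 = 1.
Proof.
have e : expC z * expC (- z) = 1 by rewrite -expCD subrr expC0.
by rewrite -[RHS]e /ccosh /csinh; field; rewrite ?pnatr_eq0.
Qed.

Lemma csinhE x y : csinh (x +i* y) = (sinh x * cos y) +i* (cosh x * sin y).
Proof.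
rewrite /csinh natC -fmorphV mulrC /expC /= cosN sinN /sinh /cosh.
by apply: eq_cplx => /=; rewrite mul0r ?subr0 ?addr0; field.
Qed.

Lemma normc_ccosh_le z : normc (ccosh z) <= expR `|complex.Re z|.
Proof.
rewrite /ccosh normcM natC -fmorphV normcR ger0_norm ?invr_ge0//.
rewrite ler_pdivrMr// mulr_natr mulr2n (le_trans (normc_leD _ _))//.
rewrite !normc_expC cReN lerD// ler_expR ?ler_norm//.
by rewrite -normrN ler_norm.
Qed.

(** The mean value theorem is applied to the real and imaginary parts
    separately, at different points; hence the factor 2. *)
Lemma cmean_value (f f' : R -> R[i]) (C : R) :
  (forall t, 0 <= t <= 1 -> cderiv f t (f' t)) ->
  (forall t, 0 <= t <= 1 -> normc (f' t) <= C) ->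
  normc (f 1 - f 0) <= 2 * C.
Proof.
move=> df bf.
have aux (g g' : R -> R) : (forall t, 0 <= t <= 1 -> is_derive t 1 g (g' t)) ->
  (forall t, 0 <= t <= 1 -> `|g' t| <= C) -> `|g 1 - g 0| <= C.
  move=> dg bg.
  have [||c + ->] := @MVT_segment _ g g' 0 1 ler01.
  - by move=> t; rewrite in_itv/= => /andP[t0 t1]; apply: dg; rewrite !ltW.
  - apply: derivable_within_continuous => t; rewrite in_itv/= => ht.
    by have [] := dg _ ht.
  by rewrite in_itv/= subr0 mulr1; exact: bg.
rewrite (le_trans (normc_le_ReIm _))// mulr_natl mulr2n cReD cImD cReN cImN.
apply: lerD.
- apply: (aux (fun t => complex.Re (f t)) (fun t => complex.Re (f' t))) => t ht.
    by have [] := df _ ht.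
  exact: le_trans (normc_Re _) (bf _ ht).
- apply: (aux (fun t => complex.Im (f t)) (fun t => complex.Im (f' t))) => t ht.
    by have [] := df _ ht.
  exact: le_trans (normc_Im _) (bf _ ht).
Qed.

Lemma cReR_M t z : complex.Re (t%:C * z) = t * complex.Re z.
Proof. by rewrite cReM /= mul0r subr0. Qed.

Lemma cImR_M t z : complex.Im (t%:C * z) = t * complex.Im z.
Proof. by rewrite cImM /= mul0r addr0. Qed.

Lemma normr_scale_le t x : 0 <= t <= 1 -> `|t * x| <= `|x|.
Proof. by move=> /andP[t0 t1]; rewrite normrM ger0_norm// ler_piMl. Qed.

Lemma csinh0 : csinh 0 = 0.
Proof. by rewrite /csinh oppr0 subrr mul0r. Qed.

Lemma normc_csinh_le_lin q :
  normc (csinh q) <= 2 * (normc q * expR `|complex.Re q|).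
Proof.
have -> : csinh q = csinh (1%:C * q) - csinh (0%:C * q).
  by rewrite mul1r mul0r csinh0 subr0.
apply: (@cmean_value (fun t => csinh (t%:C * q))
  (fun t => q * ccosh (t%:C * q))) => t ht.
  apply: cderiv_csinh; apply: cderiv_eq.
    exact: (cderivM (cderiv_id t) (cderiv_cst q t)).
  by rewrite mul1r mulr0 addr0.
rewrite normcM ler_wpM2l ?normc_ge0// (le_trans (normc_ccosh_le _))//.
by rewrite ler_expR cReR_M normr_scale_le.
Qed.

(** The third-order zero at 0 which makes the singularity of the kernel
    removable: t q cosh (t q) - sinh (t q) vanishes at t = 0 and has
    t-derivative t q^2 sinh (t q). *)
Lemma normc_cancel_le q : normc (q * ccosh q - csinh q) <=
  4 * (normc q ^+ 3 * expR `|complex.Re q|).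
Proof.
have -> : q * ccosh q - csinh q =
    (1%:C * q * ccosh (1%:C * q) - csinh (1%:C * q)) -
    (0%:C * q * ccosh (0%:C * q) - csinh (0%:C * q)).
  by rewrite !mul1r !mul0r csinh0 !subr0.
have -> : 4 * (normc q ^+ 3 * expR `|complex.Re q|) =
  2 * (normc q ^+ 2 * (2 * (normc q * expR `|complex.Re q|))) by ring.
apply: (@cmean_value (fun t => t%:C * q * ccosh (t%:C * q) - csinh (t%:C * q))
  (fun t => t%:C * q ^+ 2 * csinh (t%:C * q))) => t ht.
  have d : cderiv (fun t => t%:C * q) t q.
    apply: cderiv_eq.
      exact: (cderivM (cderiv_id t) (cderiv_cst q t)).
    by rewrite mul1r mulr0 addr0.
  apply: cderiv_eq.
    exact: (cderivB (cderivM d (cderiv_ccosh d)) (cderiv_csinh d)).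
  cbv beta; ring.
move/andP : (ht) => [t0 t1].
rewrite normcM (normcM t%:C) normcX normcR -mulrA ger0_norm//.
rewrite (@le_trans _ _ (1 * (normc q ^+ 2 * normc (csinh (t%:C * q)))))//.
  by rewrite ler_wpM2r// mulr_ge0 ?exprn_ge0 ?normc_ge0.
rewrite mul1r ler_wpM2l ?exprn_ge0 ?normc_ge0//.
rewrite (le_trans (normc_csinh_le_lin _))// ler_wpM2l// ler_pM ?normc_ge0 ?expR_ge0//.
  by rewrite normcM normcR ger0_norm// ler_piMl ?normc_ge0.
by rewrite ler_expR cReR_M normr_scale_le.
Qed.

(** sin y = 2 sin (y/2) cos (y/2) >= y cos^2 (y/2) = (y + y cos y) / 2. *)
Lemma sin_ge_half y : 0 <= y <= pi / 2 -> y / 2 <= sin y.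
Proof.
move=> /andP[y0 ypi].
have pi0 := pi_gt0 R.
have [->|yneq] := eqVneq y 0; first by rewrite mul0r sin0.
have {y0 yneq}y0 : 0 < y by rewrite lt_neqAle eq_sym yneq.
pose w := y / 2.
have w0 : 0 < w by rewrite divr_gt0.
have dsin t : t \in `]0, w[ -> is_derive t 1 (@sin R) (cos t).
  by move=> _; exact: is_derive_sin.
have csin : {within `[0, w], continuous (@sin R)}.
  by apply: derivable_within_continuous => t _; exact: derivable_sin.
have [c] := MVT_segment (ltW w0) dsin csin.
rewrite in_itv/= sin0 !subr0 => /andP[c0 cw] sw.
have piw : w <= pi by rewrite /w; lra.
have cosw : cos w <= cos c.
  move: cw; rewrite le_eqVlt => /predU1P[->//|cw].
  by rewrite ltW// ltr_cos// in_itv/= ?c0 ?(ltW w0) ?piw//= (le_trans (ltW cw)).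
have cosw0 : 0 <= cos w.
  by apply: cos_ge0_pihalf; apply/andP; split; rewrite /w; lra.
have cosy0 : 0 <= cos y.
  by apply: cos_ge0_pihalf; apply/andP; split; lra.
have yE : y = w *+ 2 by rewrite /w mulr2n; field.
have siny : sin y = 2 * (cos w * (cos c * w)) by rewrite yE sin_mulr2n sw mulr2n; ring.
have cosyE : cos y = 2 * cos w ^+ 2 - 1.
  by rewrite yE cos_mulr2n mulr2n; ring.
rewrite siny -/w.
have : cos w * cos w <= cos w * cos c by rewrite ler_wpM2l.
move=> h; have := ler_wpM2r (ltW w0) h.
have : 0 <= w * cos y by rewrite mulr_ge0 ?(ltW w0).
rewrite cosyE => h1 h2.
have -> : 2 * (cos w * (cos c * w)) = 2 * (cos w * cos c * w) by ring.
by clear -h1 h2; nra.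
Qed.

Lemma sin_sqr_ge y : `|y| <= pi / 2 -> y ^+ 2 / 4 <= sin y ^+ 2.
Proof.
move=> hy.
have -> : sin y ^+ 2 = sin `|y| ^+ 2.
  by case: (ler0P y) => // _; rewrite sinN sqrrN.
have -> : y ^+ 2 / 4 = (`|y| / 2) ^+ 2.
  by rewrite expr_div_n real_normK ?num_real//; field.
rewrite ler_sqr ?nnegrE ?divr_ge0//; last first.
  by apply: le_trans (sin_ge_half _); rewrite ?divr_ge0 ?normr_ge0.
by apply: sin_ge_half; rewrite normr_ge0.
Qed.

(** sinh x = e^(x/2) (e^(x/2) - e^(-3x/2)) / 2, whose bracket is at least x/2
    for x >= 0. *)
Lemma sinh_sqr_ge x : x ^+ 2 * expR `|x| / 16 <= sinh x ^+ 2.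
Proof.
have -> : sinh x ^+ 2 = sinh `|x| ^+ 2.
  case: (ler0P x) => // _; rewrite /sinh opprK; ring.
rewrite -(real_normK (num_real x)); move: `|x| (normr_ge0 x) => {}x x0.
have -> : x ^+ 2 * expR x / 16 = (x / 4 * expR (x / 2)) ^+ 2.
  have -> : expR x = expR (x / 2) ^+ 2 by rewrite expr2 -expRD; congr expR; field.
  by field.
have h : x / 4 * expR (x / 2) <= sinh x.
  have -> : sinh x = expR (x / 2) * (expR (x / 2) - expR (- (3 * x / 2))) / 2.
    by rewrite /sinh mulrBr -!expRD; congr (_ / _); congr (expR _ - expR _); field.
  have h1 : 1 + x / 2 <= expR (x / 2) by exact: expR_ge1Dx.
  have h2 : expR (- (3 * x / 2)) <= 1 by rewrite expR_le1; lra.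
  rewrite ler_pdivlMr// (_ : _ * 2 = expR (x / 2) * (x / 2)); last by field.
  by rewrite ler_wpM2l ?expR_ge0//; lra.
by rewrite ler_sqr ?nnegrE ?(le_trans _ h) ?mulr_ge0 ?divr_ge0 ?expR_ge0.
Qed.

Lemma cosh_ge x : expR `|x| / 2 <= cosh x.
Proof.
rewrite /cosh ler_wpM2r ?invr_ge0//.
by case: (ler0P x) => _; [rewrite lerDr|rewrite lerDl]; exact: expR_ge0.
Qed.

(** |sinh (x + i y)|^2 equals sinh^2 x + sin^2 y and also
    sinh^2 x cos^2 y + cosh^2 x sin^2 y; their sum grows with x and also stays
    large for y bounded away from 0. *)
Lemma normc_csinh_sqr_ge x y : sinh x ^+ 2 + cosh x ^+ 2 * sin y ^+ 2 <=
  2 * normc (csinh (x +i* y)) ^+ 2.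
Proof.
rewrite csinhE normc_sqr/= (exprMn 2 (sinh x)) (exprMn 2 (cosh x)).
have c2 : cosh x ^+ 2 = sinh x ^+ 2 + 1.
  have e : expR x * expR (- x) = 1 by rewrite -expRD subrr expR0.
  by rewrite -[X in _ + X]e /cosh /sinh; field.
rewrite c2 cos2sin2.
have : 0 <= sinh x ^+ 2 by exact: sqr_ge0.
have : 0 <= sin y ^+ 2 by exact: sqr_ge0.
have : sin y ^+ 2 <= 1 by rewrite sin2cos2 gerBl sqr_ge0.
by move: (sinh x ^+ 2) (sin y ^+ 2) => u v; nra.
Qed.

(** 0 is the only zero of sinh on |Im q| <= pi / 2, and it is simple; with the
    exponential growth this gives the lower bound uniformly on the strip. *)
Lemma normc_csinh_ge q : `|complex.Im q| <= pi / 2 ->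
  normc q * expR (`|complex.Re q| / 2) <= 6 * normc (csinh q).
Proof.
case: q => x y hy.
rewrite -ler_sqr ?nnegrE ?mulr_ge0 ?expR_ge0 ?normc_ge0//.
rewrite !exprMn.
have -> : expR (`|complex.Re (x +i* y)| / 2) ^+ 2 = expR `|x|.
  by rewrite expr2 -expRD; congr expR => /=; field.
have := normc_csinh_sqr_ge x y.
have h1 := sinh_sqr_ge x; have h2 := sin_sqr_ge hy; rewrite /= in h2.
have h3 : expR `|x| / 4 <= cosh x ^+ 2.
  have c := cosh_ge x.
  have e1 : 1 <= expR `|x| by rewrite -(expR0 R) ler_expR.
  rewrite (@le_trans _ _ ((expR `|x| / 2) ^+ 2))//.
    by rewrite expr_div_n; clear -e1; nra.
  by rewrite ler_sqr ?nnegrE ?(le_trans _ c) ?divr_ge0 ?expR_ge0.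
have -> : normc (x +i* y) ^+ 2 = x ^+ 2 + y ^+ 2 by rewrite normc_sqr.
have h4 : expR `|x| / 4 * (y ^+ 2 / 4) <= cosh x ^+ 2 * sin y ^+ 2.
  by apply: ler_pM => //; rewrite divr_ge0 ?expR_ge0 ?sqr_ge0.
have := sqr_ge0 (normc (csinh (x +i* y))).
move: (normc (csinh (x +i* y)) ^+ 2) => N N0 hN.
move: h1 h4 hN; move: (cosh x ^+ 2 * sin y ^+ 2) (sinh x ^+ 2) (x ^+ 2) (y ^+ 2) (expR `|x|).
by move=> a b X Y E *; lra.
Qed.

Lemma csinh_neq0 q : `|complex.Im q| <= pi / 2 -> q != 0 -> csinh q != 0.
Proof.
move=> hq q0; apply: contraTneq (normc_gt0 q0) => s0.
have := normc_csinh_ge hq; rewrite s0 normc0 mulr0 => h.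
by rewrite -leNgt -(ler_pM2r (expR_gt0 (`|complex.Re q| / 2))) mul0r.
Qed.

End HyperbolicKernel.

(** * Bounds for the kernel and its derivative *)

Section HyperbolicKernelBounds.
Variable R : realType.
Implicit Types (x y t : R) (z w q l : R[i]).

(** The form in which the zero of order 3 of the numerator cancels the
    denominator. *)
Lemma kerX_cancelE z : csinh (pi%:C * z) != 0 ->
  kerX z = pi%:C * (pi%:C * z * ccosh (pi%:C * z) - csinh (pi%:C * z)) /
           csinh (pi%:C * z) ^+ 3.
Proof. by move=> s0; rewrite /kerX; field. Qed.

Lemma Im_pi_le z : `|complex.Im z| <= 2^-1 ->
  `|complex.Im (pi%:C * z)| <= pi / 2 :> R.
Proof.
move=> hz; rewrite cImR_M normrM ger0_norm ?pi_ge0//.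
by rewrite ler_wpM2l ?pi_ge0.
Qed.

Lemma piC_neq0 : pi%:C != 0 :> R[i].
Proof. by rewrite (fmorph_eq0 (real_complex R)) gt_eqF// pi_gt0. Qed.

Lemma csinh_pi_neq0 z : z != 0 -> `|complex.Im z| <= 2^-1 ->
  csinh (pi%:C * z) != 0.
Proof.
by move=> z0 hz; rewrite csinh_neq0 ?Im_pi_le// mulf_neq0// piC_neq0.
Qed.

(** The bound holds across the removable singularity because
    the third-order zero, |q cosh q - sinh q| <= 4 |q|^3 e^|Re q|, meets the
    cube of |sinh q| >= |q| e^(|Re q|/2) / 6; at 0 itself the kernel is 0 by convention. *)
Lemma normc_kerX_le : exists2 C : R, 0 < C & forall z, `|complex.Im z| <= 2^-1 ->
  normc (kerX z) <= C * expR (- `|complex.Re z|).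
Proof.
exists (pi * (4 * 6 ^+ 3)); first by rewrite !mulr_gt0 ?exprn_gt0 ?pi_gt0.
move=> z hz; have pi0 := pi_gt0 R; have pi2 := pi_ge2 R.
have [z0|z0] := eqVneq z 0.
  rewrite z0 /kerX mulr0 csinh0 expr0n invr0 mulr0 normc0.
  by rewrite !mulr_ge0 ?expR_ge0 ?exprn_ge0 ?(ltW pi0).
have s0 := csinh_pi_neq0 z0 hz.
rewrite kerX_cancelE//.
set q := pi%:C * z in s0 *.
have hq := Im_pi_le hz; rewrite -/q in hq.
rewrite normcM normcV normcM normcR gtr0_norm// normcX.
rewrite ler_pdivrMr ?exprn_gt0 ?normc_gt0// -2!(mulrA pi) ler_wpM2l ?pi_ge0// -mulrA.
apply: (le_trans (normc_cancel_le q)).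
have rq : `|complex.Re q| = pi * `|complex.Re z|.
  by rewrite cReR_M normrM gtr0_norm.
have -> : 4 * (normc q ^+ 3 * expR `|complex.Re q|) =
    4 * expR (- (`|complex.Re q| / 2)) *
    (normc q * expR (`|complex.Re q| / 2)) ^+ 3.
  have -> : expR `|complex.Re q| =
      expR (- (`|complex.Re q| / 2)) * expR (`|complex.Re q| / 2) ^+ 3.
    by rewrite -expRM_natl -expRD; congr expR; field.
  ring.
have -> : 4 * 6 ^+ 3 * (expR (- `|complex.Re z|) * normc (csinh q) ^+ 3) =
    4 * expR (- `|complex.Re z|) * (6 * normc (csinh q)) ^+ 3 by ring.
apply: ler_pM; rewrite ?mulr_ge0 ?expR_ge0 ?exprn_ge0 ?mulr_ge0 ?normc_ge0 ?expR_ge0//.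
  rewrite ler_wpM2l// ler_expR lerN2 rq.
  have := normr_ge0 (complex.Re z); clear -pi2; nra.
rewrite lerXn2r ?nnegrE ?mulr_ge0 ?expR_ge0 ?normc_ge0//.
exact: normc_csinh_ge.
Qed.

Lemma cderiv_kerX (f : R -> R[i]) x l : csinh (pi%:C * f x) != 0 ->
  cderiv f x l -> cderiv (fun t => kerX (f t)) x (l * dkerX (f x)).
Proof.
move=> s0 df.
have dq := cderivMl pi%:C df.
have dS := cderivV s0 (cderiv_csinh dq).
have dC := cderiv_ccosh dq.
apply: (@cderiv_ext _ (fun t => pi%:C *
  (pi%:C * f t * (ccosh (pi%:C * f t) * (csinh (pi%:C * f t))^-1) - 1) *
  ((csinh (pi%:C * f t))^-1 * (csinh (pi%:C * f t))^-1))).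
  by move=> t; rewrite /kerX -invfM -expr2.
apply: cderiv_eq.
  apply: cderivM (cderivM dS dS).
  exact: cderivMl (cderivB (cderivM dq (cderivM dC dS)) (cderiv_cst 1 x)).
cbv beta; rewrite /dkerX.
have c2 : ccosh (pi%:C * f x) ^+ 2 = csinh (pi%:C * f x) ^+ 2 + 1.
  by rewrite -(cosh2_sinh2 (pi%:C * f x)) addrC subrK.
move: c2 s0; move: (ccosh _) (csinh _) => c s c2 s0.
apply/eqP; rewrite -subr_eq0.
set e := _ - _.
have -> : e = - l * pi%:C ^+ 3 * f x * (c ^+ 2 - s ^+ 2 - 1) / s ^+ 4.
  by rewrite /e; field.
by rewrite c2 [_ + 1]addrC addrK subrr mulr0 mul0r.
Qed.

(** Away from the real line |sinh (pi z)| >= (d/6) e^(pi |Re z|), so each of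
    the three terms of the derivative can be bounded on its own, with no
    cancellation. *)
Lemma normc_dkerX_le (d : R) : 0 < d ->
  exists2 C : R, 0 < C & forall z, d <= `|complex.Im z| <= 2^-1 ->
  normc (dkerX z) <= C * expR (- `|complex.Re z|).
Proof.
move=> d0; have pi0 := pi_gt0 R; have pi2 := pi_ge2 R.
pose K := 6 / d; have K0 : 0 < K by rewrite divr_gt0.
exists (3 * pi ^+ 2 * K ^+ 3 + 3 * pi ^+ 3 * K ^+ 4).
  by rewrite addr_gt0 ?(mulr_gt0 (mulr_gt0 _ (exprn_gt0 _ pi0)) (exprn_gt0 _ K0)).
move=> z /andP[dz hz].
have hq := Im_pi_le hz.
set q := pi%:C * z in hq *.
have rq : `|complex.Re q| = pi * `|complex.Re z|.
  by rewrite cReR_M normrM gtr0_norm.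
have Sge : d / 6 * expR `|complex.Re q| <= normc (csinh q).
  rewrite -ler_sqr ?nnegrE ?mulr_ge0 ?expR_ge0 ?divr_ge0 ?normc_ge0 ?(ltW d0)//.
  have := normc_csinh_sqr_ge (complex.Re q) (complex.Im q).
  have -> : complex.Re q +i* complex.Im q = q by apply: eq_cplx.
  have h1 : expR `|complex.Re q| ^+ 2 / 4 <= cosh (complex.Re q) ^+ 2.
    have -> : expR `|complex.Re q| ^+ 2 / 4 = (expR `|complex.Re q| / 2) ^+ 2.
      by rewrite expr_div_n; congr (_ / _); ring.
    have c := cosh_ge (complex.Re q).
    by rewrite ler_sqr ?nnegrE ?(le_trans _ c) ?divr_ge0 ?expR_ge0.
  have h2 : d ^+ 2 <= sin (complex.Im q) ^+ 2.
    apply: le_trans (sin_sqr_ge hq).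
    rewrite cImR_M -[in leRHS]real_normK ?num_real// normrM (gtr0_norm pi0).
    rewrite (_ : _ / 4 = (pi * `|complex.Im z| / 2) ^+ 2); last first.
      by rewrite expr_div_n; congr (_ / _); ring.
    rewrite ler_sqr ?nnegrE ?divr_ge0 ?mulr_ge0 ?pi_ge0 ?(ltW d0)//.
    by clear -pi2 dz d0; nra.
  have h3 : expR `|complex.Re q| ^+ 2 / 4 * d ^+ 2 <=
      cosh (complex.Re q) ^+ 2 * sin (complex.Im q) ^+ 2.
    by apply: ler_pM => //; rewrite ?divr_ge0 ?sqr_ge0.
  have h4 := sqr_ge0 (sinh (complex.Re q)).
  have h5 : 0 <= d ^+ 2 * expR `|complex.Re q| ^+ 2.
    by rewrite mulr_ge0 ?sqr_ge0.
  move: h3 h4 h5; move: (cosh _ ^+ 2 * _) (sinh _ ^+ 2) (normc _ ^+ 2) => u v w.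
  by move: (expR _) => E h3 h4 h5 h6; clear -h3 h4 h5 h6; nra.
have s0 : csinh q != 0.
  apply: contraTneq Sge => ->; rewrite normc0 -ltNge.
  by rewrite mulr_gt0 ?expR_gt0 ?divr_gt0.
rewrite /dkerX -/q.
set S := (csinh q)^-1.
have hS : normc S <= K * expR (- `|complex.Re q|).
  have Ke0 : 0 < K * expR (- `|complex.Re q|) by rewrite mulr_gt0 ?expR_gt0.
  rewrite /S normcV -[leRHS]invrK lef_pV2 ?posrE ?normc_gt0 ?invr_gt0//.
  by rewrite invfM expRN invrK /K invf_div.
have hC : normc (ccosh q * S) <= K.
  rewrite normcM (le_trans (ler_pM (normc_ge0 _) (normc_ge0 _) (normc_ccosh_le q) hS))//.
  by rewrite mulrCA -expRD subrr expR0 mulr1.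
set Ct := ccosh q * S in hC *.
have e1 : expR (- `|complex.Re q|) <= expR (- (2 * `|complex.Re z|)).
  by rewrite ler_expR lerN2 rq ler_wpM2r.
have E1 : expR (- `|complex.Re z|) <= 1 by rewrite expR_le1 oppr_le0.
have hT : normc S <= K * expR (- `|complex.Re z|) ^+ 2.
  rewrite (le_trans hS)// ler_wpM2l ?(ltW K0)// (le_trans e1)//.
  by rewrite -expRM_natl mulrN.
have hz' : normc z * expR (- `|complex.Re z|) <= 1.
  rewrite expRN ler_pdivrMr ?expR_gt0// mul1r.
  rewrite (le_trans (normc_le_ReIm z))// (le_trans _ (expR_ge1Dx _))// addrC.
  by rewrite lerD2r (le_trans hz)// invf_le1// ler1n.
set E := expR (- `|complex.Re z|) in E1 hT hz' *.
have E0 : 0 <= E := expR_ge0 _.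
have nN n : normc (n%:R : R[i]) = n%:R.
  by rewrite natC normcR ger0_norm.
have hS1 : normc S <= K * E.
  by rewrite (le_trans hT)// ler_wpM2l ?(ltW K0)// expr2 ler_piMl.
have hS2 : normc S ^+ 2 <= K ^+ 2 * E ^+ 2.
  rewrite -exprMn; apply: lerXn2r hS1; rewrite nnegrE ?normc_ge0//.
  by rewrite mulr_ge0 ?(ltW K0).
have hS4 : normc S ^+ 4 <= K ^+ 4 * E ^+ 2.
  rewrite (exprM (normc S) 2 2) (exprM K 2 2).
  have h : (normc S ^+ 2) ^+ 2 <= (K ^+ 2 * E ^+ 2) ^+ 2.
    apply: lerXn2r hS2; rewrite nnegrE ?exprn_ge0 ?normc_ge0//.
    by rewrite mulr_ge0 ?exprn_ge0 ?(ltW K0).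
  rewrite (le_trans h)// exprMn ler_wpM2l ?exprn_ge0 ?(ltW K0)//.
  by rewrite [leLHS]expr2 ler_piMl ?exprn_ge0// exprn_ile1.
have hC2 : normc Ct ^+ 2 <= K ^+ 2.
  by apply: lerXn2r hC; rewrite nnegrE ?normc_ge0 ?(ltW K0).
have hEz : normc z * E ^+ 2 <= E by rewrite expr2 mulrA ler_piMl.
rewrite (le_trans (normc_leB _ _))// (le_trans (lerD (normc_leB _ _) (lexx _)))//.
have -> : normc (3%:R * pi%:C ^+ 2 * Ct * S ^+ 2) =
    3 * pi ^+ 2 * normc Ct * normc S ^+ 2.
  by rewrite normcM (normcM _ Ct) (normcM 3%:R) !normcX normcR nN gtr0_norm.
have -> : normc (pi%:C ^+ 3 * z * S ^+ 4) = pi ^+ 3 * normc z * normc S ^+ 4.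
  by rewrite normcM (normcM _ z) !normcX normcR gtr0_norm.
have -> : normc (2%:R * pi%:C ^+ 3 * z * Ct ^+ 2 * S ^+ 2) =
    2 * pi ^+ 3 * normc z * normc Ct ^+ 2 * normc S ^+ 2.
  rewrite normcM (normcM _ (Ct ^+ 2)) (normcM _ z) (normcM 2%:R) !normcX.
  by rewrite normcR nN gtr0_norm.
have t1 : 3 * pi ^+ 2 * normc Ct * normc S ^+ 2 <= 3 * pi ^+ 2 * K ^+ 3 * E.
  have -> : 3 * pi ^+ 2 * K ^+ 3 * E = 3 * pi ^+ 2 * K * (K ^+ 2 * E) by ring.
  apply: ler_pM; rewrite ?mulr_ge0 ?exprn_ge0 ?normc_ge0 ?(ltW pi0)//.
    by rewrite ler_wpM2l ?mulr_ge0 ?exprn_ge0 ?(ltW pi0).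
  by rewrite (le_trans hS2)// ler_wpM2l ?exprn_ge0 ?(ltW K0)// expr2 ler_piMl.
have t2 : pi ^+ 3 * normc z * normc S ^+ 4 <= pi ^+ 3 * K ^+ 4 * E.
  rewrite -2!(mulrA (pi ^+ 3)) ler_wpM2l ?exprn_ge0 ?(ltW pi0)//.
  rewrite (le_trans (ler_wpM2l (normc_ge0 _) hS4))// mulrCA.
  by rewrite ler_wpM2l ?exprn_ge0 ?(ltW K0).
have t3 : 2 * pi ^+ 3 * normc z * normc Ct ^+ 2 * normc S ^+ 2 <=
    2 * pi ^+ 3 * K ^+ 4 * E.
  have -> : 2 * pi ^+ 3 * normc z * normc Ct ^+ 2 * normc S ^+ 2 =
     2 * pi ^+ 3 * (normc z * (normc Ct ^+ 2 * normc S ^+ 2)) by ring.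
  rewrite -(mulrA (2 * pi ^+ 3)) ler_wpM2l ?mulr_ge0 ?exprn_ge0 ?(ltW pi0)//.
  have h : normc Ct ^+ 2 * normc S ^+ 2 <= K ^+ 4 * E ^+ 2.
    rewrite (exprM K 2 2) [_ ^+ 2 ^+ 2]expr2 -mulrA.
    by apply: ler_pM; rewrite ?exprn_ge0 ?normc_ge0.
  rewrite (le_trans (ler_wpM2l (normc_ge0 _) h))// mulrCA.
  by rewrite ler_wpM2l ?exprn_ge0 ?(ltW K0).
rewrite mulrDl; move: t1 t2 t3; lra.
Qed.

End HyperbolicKernelBounds.

(** * Integrals invariant under a shift of the contour *)

Section Decay.
Variable R : realType.
Implicit Types (x y t : R).
Local Notation leb := (@lebesgue_measure R).

(** The kernel is O(e^(-|x|)) and the power O(e^(|x|/2)). *)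
Definition decay x : R := expR (- (`|x| / 2)).

Lemma decay_ge0 x : 0 <= decay x. Proof. exact: expR_ge0. Qed.

Lemma decay_bound_ge0 (C x v : R) : `|v| <= C * decay x -> 0 <= C.
Proof.
by move=> /(le_trans (normr_ge0 v)); rewrite pmulr_lge0 ?expR_gt0.
Qed.

Lemma continuous_decay : continuous decay.
Proof.
move=> x; apply: continuous_comp; last exact: continuous_expR.
apply: cvgN; apply: cvgMr_tmp; exact: norm_continuous.
Qed.

Lemma measurable_decay : measurable_fun [set: R] decay.
Proof. exact: continuous_measurable_fun continuous_decay. Qed.

Lemma integrable_decay : leb.-integrable setT (EFin \o decay).
Proof.
apply/integrableP; split.
  by apply/measurable_EFinP; exact: measurable_decay.
under eq_integral do rewrite /= ger0_norm ?decay_ge0//.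
rewrite ge0_symfun_integralT; last 3 first.
- exact: decay_ge0.
- exact: continuous_decay.
- by move=> x /=; rewrite /decay normrN.
rewrite -set_itvcy lte_mul_pinfty//.
have half0 : 0 < 2^-1 :> R by rewrite invr_gt0.
have -> : (\int[leb]_(x in `[0%R, +oo[) (decay x)%:E =
   \int[leb]_(x in `[0%R, +oo[) (2%:E * (exponential_pdf 2^-1 x)%:E))%E.
  apply: eq_integral => x; rewrite inE/= in_itv/= andbT => x0.
  rewrite exponential_pdfE// /decay ger0_norm// -EFinM mulrA divff// mul1r.
  by rewrite mulNr mulrC.
have /integrableP[_] : leb.-integrable `[0%R, +oo[
    (fun x => 2%:E * (exponential_pdf 2^-1 x)%:E)%E.
  apply: integrableZl => //.
  exact: integrableS (integrable_exponential_pdf half0).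
apply: le_lt_trans; apply: ge0_le_integral => //.
- move=> x _; rewrite mule_ge0// lee_fin exponential_pdf_ge0//.
- apply/measurable_EFinP; apply: measurable_funM => //.
  exact: measurable_funTS (measurable_exponential_pdf _).
- apply: measurableT_comp => //.
  apply/measurable_EFinP; apply: measurable_funM => //.
  exact: measurable_funTS (measurable_exponential_pdf _).
- by move=> x _; exact: lee_abs.
Qed.

Lemma integrable_le_decay (f : R -> R) (C : R) : measurable_fun [set: R] f ->
  (forall x, `|f x| <= C * decay x) -> leb.-integrable setT (EFin \o f).
Proof.
move=> mf fC; apply: (@le_integrable _ _ _ leb setT _ _
  (fun x => C%:E * (decay x)%:E)%E) => //.
- exact/measurable_EFinP.
- move=> x _ /=; rewrite lee_fin (le_trans (fC x))// ler_norm//.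
- exact: integrableZl integrable_decay.
Qed.

(** The integral over [-n, n] is a difference of values of q, which tends to
    0. *)
Lemma integral_derive_decay (q g : R -> R) (C C' : R) :
  (forall x, is_derive x 1 q (g x)) -> continuous g ->
  (forall x, `|q x| <= C * decay x) -> (forall x, `|g x| <= C' * decay x) ->
  \int[leb]_x g x = 0.
Proof.
move=> dq cg qC gC.
have mg : measurable_fun [set: R] g by exact: continuous_measurable_fun.
have ig := integrable_le_decay mg gC.
pose I (n : nat) := `[- n.+1%:R, n.+1%:R]%classic : set R.
have FTC n : (\int[leb]_(x in I n) (g x)%:E =
    (q n.+1%:R)%:E - (q (- n.+1%:R))%:E)%E.
  have cq : continuous q.
    move=> x; apply/differentiable_continuous/derivable1_diffP.
    by have [] := dq x.
  apply: continuous_FTC2.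
  - by rewrite (@lt_trans _ _ 0)// oppr_lt0.
  - exact: continuous_subspaceT.
  - split => [x _||]; first by have [] := dq x.
    + exact/cvg_at_right_filter/cq.
    + exact/cvg_at_left_filter/cq.
  - by move=> x _; rewrite derive1E; have [] := dq x.
have lim1 : (\int[leb]_(x in I n) (g x)%:E)%E @[n --> \oo] -->
    (\int[leb]_x (g x)%:E)%E.
  under eq_fun do rewrite integral_mkcond.
  have m1 n : measurable_fun [set: R] ((EFin \o g) \_ (I n)).
    apply/(measurable_restrictT _ _).1; first exact: measurable_itv.
    by apply: measurable_funTS; apply/measurable_EFinP.
  have m2 : measurable_fun [set: R] (EFin \o g) by exact/measurable_EFinP.
  have c1 : {ae leb, forall x, [set: R] x ->
      ((EFin \o g) \_ (I n)) x @[n --> \oo] --> (EFin \o g) x}.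
    apply/aeW => x _; apply: cvg_near_cst.
    exists `|Num.ceil `|x| |%N => // n /= xn; rewrite patchE ifT// inE /I/= in_itv/=.
    rewrite -ler_norml (le_trans (ceil_ge _))//.
    have : `|Num.ceil `|x| |%N%:R <= n%:R :> R by rewrite ler_nat.
    rewrite natr_absz ger0_norm ?ceil_ge0 ?(lt_le_trans (ltrN10 _))// => h.
    by rewrite (le_trans h)// ler_nat.
  have i1 : leb.-integrable setT (fun x => (C'%:E * (decay x)%:E)%E).
    exact: integrableZl integrable_decay.
  have b1 : {ae leb, forall x n, [set: R] x ->
      (`|((EFin \o g) \_ (I n)) x| <= C'%:E * (decay x)%:E)%E}.
    apply/aeW => x n _; rewrite patchE; case: ifPn => _ /=.
      by rewrite lee_fin gC.
    by rewrite normr0 lee_fin (le_trans _ (gC x)).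
  by have [_ _] := @dominated_convergence _ _ _ leb setT measurableT
    (fun n => (EFin \o g) \_ (I n)) _ _ m1 m2 c1 i1 b1.
have lim2 : (\int[leb]_(x in I n) (g x)%:E)%E @[n --> \oo] --> 0%E.
  under eq_fun do rewrite FTC -EFinB.
  apply: cvg_EFin; first exact: nearW.
  apply: norm_cvg0; apply: (@squeeze_cvgr _ _ _ _ (cst 0)
    (fun n : nat => 2 * C * expR (- (2^-1 * n.+1%:R)))).
  - apply: nearW => n; rewrite normr_ge0/= (le_trans (ler_normB _ _))//.
    rewrite (le_trans (lerD (qC _) (qC _)))//.
    rewrite /decay normrN ger0_norm// (mulrC 2^-1) le_eqVlt; apply/orP; left.
    by apply/eqP; ring.
  - exact: cvg_cst.
  - rewrite -[X in _ --> X](mulr0 (2 * C)); apply: cvgMl_tmp.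
    have h : ((fun r : R => 2^-1 * r) \o (fun n : nat => n.+1%:R)) @ \oo --> +oo%R.
      have half0 : 0 < 2^-1 :> R by rewrite invr_gt0.
      have hn : (fun n : nat => n.+1%:R : R) @ \oo --> +oo%R.
        by rewrite (cvg_shiftS (fun n => n%:R : R)); exact: cvgr_idn.
      have hM : (2^-1 * r : R) @[r --> +oo%R] --> +oo%R.
        exact: (gt0_cvgMry half0 (@cvg_id _ _)).
      apply: cvg_trans hM.
      have := cvg_app (fun r : R => 2^-1 * r) hn.
      by [].
    apply: cvg_trans (@cvgr_expR R).
    have := cvg_app (fun r : R => expR (- r)) h.
    by [].
have := cvg_unique _ lim1 lim2 => /= h.
by rewrite /Rintegral h.
Qed.

(** Cauchy's theorem for an infinite strip, without complex integrals: the
    derivative in t of the integral of P t is the integral of g t, which is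
    also the x-derivative of a decaying function Q t and so has integral 0.
    Since the integrand may be singular at x = 0 when t = 0, the point t = 0 is
    reached only by continuity, with dominated convergence; the derivative is
    bounded only for t > e > 0.  The margin eta makes 0 and 1 interior points
    of the range of t. *)
Lemma shift_invariance (P Q g : R -> R -> R) (eta C : R) : 0 < eta ->
  (forall t, - eta < t < 1 + eta -> measurable_fun [set: R] (P t)) ->
  (forall t x, - eta < t < 1 + eta -> `|P t x| <= C * decay x) ->
  (forall x, x != 0 -> {in `](- eta), (1 + eta)[, continuous (P^~ x)}) ->
  (forall t x, 0 < t < 1 -> is_derive t 1 (P^~ x) (g t x)) ->
  (forall t x, 0 < t < 1 -> is_derive x 1 (Q t) (g t x)) ->
  (forall t, 0 < t < 1 -> continuous (g t)) ->
  (forall t, 0 < t < 1 -> exists C', forall x, `|Q t x| <= C' * decay x) ->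
  (forall e : R, 0 < e -> exists C', forall t x, e < t < 1 ->
     `|g t x| <= C' * decay x) ->
  \int[leb]_x P 0 x = \int[leb]_x P 1 x.
Proof.
move=> eta0 mP PC cP dP dQ cg QC gC.
have C0 : 0 <= C.
  have h : - eta < 0 < 1 + eta by apply/andP; split; lra.
  exact: decay_bound_ge0 (PC 0 0 h).
have iP t : - eta < t < 1 + eta -> leb.-integrable setT (EFin \o P t).
  by move=> ht; apply: (@integrable_le_decay _ C) => [|x]; [exact: mP|exact: PC].
pose F t := \int[leb]_x P t x.
have cF : {in `](- eta), (1 + eta)[, continuous F}.
  move=> t ht; apply: (@continuity_under_integral R _ _ leb P setT measurableT
    (- eta) (1 + eta) _ _ (fun x => C * decay x)).
  - by move=> s; rewrite /= in_itv/=; exact: iP.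
  - have : leb.-negligible [set 0 : R].
      by apply/negligibleP => //; exact: lebesgue_measure_set1.
    apply: negligibleS => x /=; apply: contra_notP => /eqP x0 _ s.
    by rewrite inE/= => hs; apply: cP.
  - exact: integrableZl integrable_decay.
  - move=> s; rewrite /= in_itv/= => hs; apply/aeW => x _; exact: PC.
  - by rewrite inE.
have dF t : t \in `]0, 1[ -> is_derive t 1 F 0.
  rewrite in_itv/= => /andP[t0 t1].
  have [C' hC'] := gC (t / 2) (divr_gt0 t0 (ltr0Sn _ 1)).
  have ht2 : t \in `](t / 2), 1[ by rewrite in_itv/=; apply/andP; split; lra.
  have in01 s : s \in `](t / 2), 1[ -> 0 < s < 1.
    by rewrite in_itv/= => /andP[? ?]; apply/andP; split; lra.
  have intP s : [set` `](t / 2), 1[] s -> leb.-integrable setT (EFin \o P s).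
    by move=> /in01 /andP[? ?]; apply: iP; apply/andP; split; lra.
  have derP s x : [set` `](t / 2), 1[] s -> [set: R] x -> derivable (P^~ x) s 1.
    by move=> /in01 hs _; have [] := dP s x hs.
  have d1E s x : 0 < s < 1 -> partial1of2 P s x = g s x.
    by move=> hs; rewrite partial1of2E; have [_ ->] := dP s x hs.
  have C'0 : 0 <= C'.
    have h : t / 2 < t < 1 by apply/andP; split; lra.
    exact: decay_bound_ge0 (hC' t 0 h).
  have iG : leb.-integrable setT (EFin \o (fun x => C' * decay x)).
    exact: integrableZl integrable_decay.
  have G0 x : 0 <= C' * decay x by rewrite mulr_ge0 ?decay_ge0.
  have Gub s x : [set` `](t / 2), 1[] s -> [set: R] x ->
      `|partial1of2 P s x| <= C' * decay x.
    by move=> hs _; rewrite d1E ?in01//; apply: hC'; move: hs; rewrite /= in_itv.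
  have D := @derivable_under_integral R _ _ leb P setT measurableT t (t / 2) 1
    ht2 intP derP _ G0 iG Gub.
  have E := @differentiation_under_integral R _ _ leb P setT measurableT t (t / 2) 1
    ht2 intP derP _ G0 iG Gub.
  apply: DeriveDef => //; rewrite -derive1E E.
  have ht01 : 0 < t < 1 by rewrite t0.
  have [C1 hC1] := QC t ht01.
  rewrite -[RHS](@integral_derive_decay (Q t) (g t) C1 C').
  - by apply: eq_Rintegral => x _; rewrite d1E.
  - by move=> x; exact: dQ.
  - exact: cg.
  - exact: hC1.
  - by move=> x; apply: hC'; rewrite t1 andbT; lra.
have cF01 : {within `[0, 1], continuous F}.
  apply: continuous_in_subspaceT => t; rewrite inE/= in_itv/= => /andP[t0 t1].
  by apply: cF; rewrite in_itv/=; apply/andP; split; lra.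
have [c _] := MVT_segment ler01 dF cF01.
by rewrite mul0r => /eqP; rewrite subr_eq0 => /eqP.
Qed.

End Decay.

(** * Measurability and differentiability of complex expressions *)

Section ComplexMeasurability.
Context (R : realType) (d : measure_display) (T : measurableType d).
Implicit Types (f g : T -> R[i]) (h : T -> R).

Definition cmeas f : Prop :=
  measurable_fun [set: T] (fun t => complex.Re (f t)) /\
  measurable_fun [set: T] (fun t => complex.Im (f t)).

Lemma cmeas_cst (z : R[i]) : cmeas (fun=> z).
Proof. by split; exact: measurable_cst. Qed.

Lemma cmeas_R h : measurable_fun [set: T] h -> cmeas (fun t => (h t)%:C).
Proof. by move=> mh; split => //=; exact: measurable_cst. Qed.

Lemma cmeas_pair h1 h2 : measurable_fun [set: T] h1 ->
  measurable_fun [set: T] h2 -> cmeas (fun t => h1 t +i* h2 t).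
Proof. by move=> m1 m2; split. Qed.

Lemma cmeasD f g : cmeas f -> cmeas g -> cmeas (fun t => f t + g t).
Proof.
move=> [f1 f2] [g1 g2]; split.
- under eq_fun do rewrite cReD; exact: measurable_funD.
- under eq_fun do rewrite cImD; exact: measurable_funD.
Qed.

Lemma cmeasN f : cmeas f -> cmeas (fun t => - f t).
Proof.
move=> [f1 f2]; split.
- under eq_fun do rewrite cReN; exact: measurable_funN.
- under eq_fun do rewrite cImN; exact: measurable_funN.
Qed.

Lemma cmeasB f g : cmeas f -> cmeas g -> cmeas (fun t => f t - g t).
Proof. by move=> mf mg; apply: cmeasD => //; exact: cmeasN. Qed.

Lemma cmeasM f g : cmeas f -> cmeas g -> cmeas (fun t => f t * g t).
Proof.
move=> [f1 f2] [g1 g2]; split.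
- under eq_fun do rewrite cReM.
  by apply: measurable_funB; apply: measurable_funM.
- under eq_fun do rewrite cImM.
  by apply: measurable_funD; apply: measurable_funM.
Qed.

Lemma measurable_inv_ge0 h : (forall t, 0 <= h t) ->
  measurable_fun [set: T] h -> measurable_fun [set: T] (fun t => (h t)^-1).
Proof.
move=> h0 mh; under eq_fun do rewrite -powR_inv1//.
have := measurableT_comp (@measurable_powR R (-1)) mh.
by [].
Qed.

Lemma measurable_invr h : measurable_fun [set: T] h ->
  measurable_fun [set: T] (fun t => (h t)^-1).
Proof.
move=> mh.
have -> : (fun t => (h t)^-1) = (fun t => h t * (h t ^+ 2)^-1).
  apply/funext => t; have [->|h0] := eqVneq (h t) 0; first by rewrite invr0 mul0r.
  by field.
apply: measurable_funM => //; apply: measurable_inv_ge0.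
  by move=> t; exact: sqr_ge0.
exact: measurable_funX.
Qed.

Lemma cmeasV f : cmeas f -> cmeas (fun t => (f t)^-1).
Proof.
move=> [f1 f2].
have m : measurable_fun [set: T]
    (fun t => (complex.Re (f t) ^+ 2 + complex.Im (f t) ^+ 2)^-1).
  by apply: measurable_invr; apply: measurable_funD; exact: measurable_funX.
split.
- have -> : (fun t => complex.Re (f t)^-1) = (fun t => complex.Re (f t) *
    (complex.Re (f t) ^+ 2 + complex.Im (f t) ^+ 2)^-1).
    by apply/funext => t; case: (f t).
  exact: measurable_funM.
- have -> : (fun t => complex.Im (f t)^-1) = (fun t => - (complex.Im (f t) *
    (complex.Re (f t) ^+ 2 + complex.Im (f t) ^+ 2)^-1)).
    by apply/funext => t; case: (f t).
  by apply: measurable_funN; exact: measurable_funM.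
Qed.

Lemma cmeasX f n : cmeas f -> cmeas (fun t => f t ^+ n).
Proof.
move=> mf; elim: n => [|n ih]; first exact: cmeas_cst.
by under eq_fun do rewrite exprS; exact: cmeasM.
Qed.

Lemma cmeas_expC f : cmeas f -> cmeas (fun t => expC (f t)).
Proof.
move=> [f1 f2]; split => /=.
- apply: measurable_funM.
    exact: measurableT_comp (@measurable_expR R) f1.
  apply: measurableT_comp f2.
  exact: continuous_measurable_fun (@continuous_cos R).
- apply: measurable_funM.
    exact: measurableT_comp (@measurable_expR R) f1.
  apply: measurableT_comp f2.
  exact: continuous_measurable_fun (@continuous_sin R).
Qed.

Lemma cmeas_csinh f : cmeas f -> cmeas (fun t => csinh (f t)).
Proof.
move=> mf; apply: cmeasM; last exact: cmeas_cst.
by apply: cmeasB; apply: cmeas_expC => //; exact: cmeasN.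
Qed.

Lemma cmeas_ccosh f : cmeas f -> cmeas (fun t => ccosh (f t)).
Proof.
move=> mf; apply: cmeasM; last exact: cmeas_cst.
by apply: cmeasD; apply: cmeas_expC => //; exact: cmeasN.
Qed.

Lemma cmeas_kerX f : cmeas f -> cmeas (fun t => kerX (f t)).
Proof.
move=> mf; have mp : cmeas (fun t => pi%:C * f t).
  by apply: cmeasM => //; exact: cmeas_cst.
have mi := cmeasV (cmeas_csinh mp).
apply: cmeasM; last by apply: cmeasV; apply: cmeasX; exact: cmeas_csinh.
apply: cmeasM; first exact: cmeas_cst.
apply: cmeasB; last exact: cmeas_cst.
by apply: cmeasM => //; apply: cmeasM => //; exact: cmeas_ccosh.
Qed.

Lemma cmeas_logH f : cmeas f -> cmeas (fun t => logH (f t)).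
Proof.
move=> [f1 f2]; split => /=.
- apply: measurable_funM; last exact: measurable_cst.
  apply: (measurableT_comp (@measurable_ln R)).
  by apply: measurable_funD; exact: measurable_funX.
- apply: (measurableT_comp (continuous_measurable_fun (@continuous_atan R))).
  by apply: measurable_funM => //; exact: measurable_invr.
Qed.

Lemma cmeas_powH f s : cmeas f -> cmeas (fun t => powH (f t) s).
Proof.
move=> mf; apply: cmeas_expC; apply: cmeasM; first exact: cmeas_cst.
exact: cmeas_logH.
Qed.

Lemma measurable_normc f : cmeas f -> measurable_fun [set: T] (fun t => normc (f t)).
Proof.
move=> [f1 f2].
have -> : (fun t => normc (f t)) =
    (fun t => Num.sqrt (complex.Re (f t) ^+ 2 + complex.Im (f t) ^+ 2)).
  by apply/funext => t; case: (f t).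
apply: (measurableT_comp (continuous_measurable_fun (@sqrt_continuous R))).
by apply: measurable_funD; exact: measurable_funX.
Qed.

(** acos is monotone only on [-1, 1]; the clamp makes the composition monotone
    on the whole line. *)
Lemma measurable_acos_clamp :
  measurable_fun [set: R] (fun x : R => acos (Num.max (-1) (Num.min x 1))).
Proof.
have clamp x : (-1 : R) <= Num.max (-1) (Num.min x 1) <= 1.
  by rewrite le_max lexx/= ge_max ge_min lexx orbT andbT (le_trans (lerN10 _) ler01).
apply: nonincreasing_measurable => // x y xy.
have [hx hy] := (clamp x, clamp y).
have : Num.max (-1) (Num.min x 1) <= Num.max (-1) (Num.min y 1).
  by rewrite ge_max !le_max lexx/= le_min !ge_min xy lexx !orbT.
move: hx hy; move: (Num.max _ _) (Num.max _ _) => {}x {}y hx hy {}xy.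
rewrite leNgt; apply/negP.
rewrite -ltr_cos ?acosK ?in_itv//= ?acos_ge0 ?acos_lepi//.
by rewrite ltNge xy.
Qed.

Lemma cmeas_logC f : cmeas f -> cmeas (fun t => logC (f t)).
Proof.
move=> mf; have [f1 f2] := mf; split => /=.
  exact: (measurableT_comp (@measurable_ln R)) (measurable_normc mf).
have mc : measurable_fun [set: T]
    (fun t => acos (complex.Re (f t) / normc (f t))).
  have -> : (fun t => acos (complex.Re (f t) / normc (f t))) =
      (fun x : R => acos (Num.max (-1) (Num.min x 1))) \o
      (fun t => complex.Re (f t) / normc (f t)).
    apply/funext => t /=.
    suff /andP[h1 h2] : -1 <= complex.Re (f t) / normc (f t) <= 1.
      by rewrite min_l// max_r.
    rewrite -ler_norml normrM.
    have [->|n0] := eqVneq (normc (f t)) 0.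
      by rewrite invr0 normr0 mulr0.
    rewrite normfV (ger0_norm (normc_ge0 _)) ler_pdivrMr ?mul1r ?normc_Re//.
    by rewrite lt_neqAle eq_sym n0 normc_ge0.
  apply: measurableT_comp; first exact: measurable_acos_clamp.
  apply: measurable_funM => //; apply: measurable_invr.
  exact: measurable_normc.
rewrite /argC; apply: measurable_fun_ifT => //.
  by apply: measurable_fun_ler => //; exact: measurable_cst.
exact: measurable_funN.
Qed.

Lemma cmeas_powC f s : cmeas f -> cmeas (fun t => powC (f t) s).
Proof.
move=> mf; apply: cmeas_expC; apply: cmeasM; first exact: cmeas_cst.
exact: cmeas_logC.
Qed.

End ComplexMeasurability.

Section ComplexDifferentiability.
Variable R : realType.
Implicit Types (f g : R -> R[i]) (x : R).

Definition cdiff f x : Prop := exists l, cderiv f x l.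

Lemma cdiff_continuous f x : cdiff f x ->
  {for x, continuous (fun t => complex.Re (f t))} /\
  {for x, continuous (fun t => complex.Im (f t))}.
Proof.
by move=> [l [[d1 _] [d2 _]]]; split;
  apply/differentiable_continuous/derivable1_diffP.
Qed.

Lemma cdiff_cst (z : R[i]) x : cdiff (fun=> z) x.
Proof. by eexists; exact: cderiv_cst. Qed.

Lemma cdiffD f g x : cdiff f x -> cdiff g x -> cdiff (fun t => f t + g t) x.
Proof. by move=> [l df] [m dg]; eexists; exact: cderivD df dg. Qed.

Lemma cdiffB f g x : cdiff f x -> cdiff g x -> cdiff (fun t => f t - g t) x.
Proof. by move=> [l df] [m dg]; eexists; exact: cderivB df dg. Qed.

Lemma cdiffM f g x : cdiff f x -> cdiff g x -> cdiff (fun t => f t * g t) x.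
Proof. by move=> [l df] [m dg]; eexists; exact: cderivM df dg. Qed.

Lemma cdiffX f n x : cdiff f x -> cdiff (fun t => f t ^+ n) x.
Proof.
move=> df; elim: n => [|n ih]; first exact: cdiff_cst.
by under eq_fun do rewrite exprS; exact: cdiffM.
Qed.

Lemma cdiffV f x : f x != 0 -> cdiff f x -> cdiff (fun t => (f t)^-1) x.
Proof. by move=> fx0 [l df]; eexists; exact: cderivV fx0 df. Qed.

Lemma cdiff_dkerX f x : csinh (pi%:C * f x) != 0 -> cdiff f x ->
  cdiff (fun t => dkerX (f t)) x.
Proof.
move=> s0 df; have dp : cdiff (fun t => pi%:C * f t) x.
  by apply: cdiffM => //; exact: cdiff_cst.
have dS : cdiff (fun t => (csinh (pi%:C * f t))^-1) x.
  apply: cdiffV => //; have [l dl] := dp; eexists; exact: cderiv_csinh dl.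
have dC : cdiff (fun t => ccosh (pi%:C * f t)) x.
  have [l dl] := dp; eexists; exact: cderiv_ccosh dl.
rewrite /dkerX; apply: cdiffB; [apply: cdiffB|].
- apply: cdiffM; last exact: cdiffX.
  by apply: cdiffM; [exact: cdiff_cst|exact: cdiffM].
- apply: cdiffM; last exact: cdiffX.
  by apply: cdiffM => //; exact: cdiff_cst.
- apply: cdiffM; last exact: cdiffX.
  apply: cdiffM; last by apply: cdiffX; exact: cdiffM.
  by apply: cdiffM => //; exact: cdiff_cst.
Qed.

End ComplexDifferentiability.

(** * Shift of the kernel *)

Section ContourShift.
Variable R : realType.
Local Notation leb := (@lebesgue_measure R).

(** When the t-derivative of H is a constant times its x-derivative, as for a
    holomorphic function of x + i t h, the two parts of z H t play the role of
    the function Q in the real statement. *)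
Lemma contour_shift (H G : R -> R -> R[i]) (z : R[i]) (eta C : R) : 0 < eta ->
  (forall t, - eta < t < 1 + eta -> cmeas (H t)) ->
  (forall t x, - eta < t < 1 + eta -> normc (H t x) <= C * decay x) ->
  (forall t x, x != 0 -> - eta < t < 1 + eta -> cdiff (H^~ x) t) ->
  (forall t x, 0 < t < 1 -> cderiv (H^~ x) t (z * G t x)) ->
  (forall t x, 0 < t < 1 -> cderiv (H t) x (G t x)) ->
  (forall t x, 0 < t < 1 -> cdiff (G t) x) ->
  (forall e : R, 0 < e -> exists C', forall t x, e < t < 1 ->
     normc (G t x) <= C' * decay x) ->
  integralC leb (H 0) = integralC leb (H 1).
Proof.
move=> eta0 mH HC cH dHt dHx cG GC.
have wide t : 0 < t < 1 -> - eta < t < 1 + eta.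
  by move=> /andP[? ?]; apply/andP; split; lra.
have dzH t x (ht : 0 < t < 1) := cderivMl z (dHx t x ht).
have czG t x : 0 < t < 1 -> cdiff (fun x => z * G t x) x.
  by move=> ht; apply: cdiffM; [exact: cdiff_cst|exact: cG].
have zHC t : 0 < t < 1 -> exists C', forall x, normc (z * H t x) <= C' * decay x.
  move=> ht; exists (normc z * C) => x.
  by rewrite normcM -mulrA ler_wpM2l ?normc_ge0// HC ?wide.
have zGC (e : R) : 0 < e -> exists C', forall t x, e < t < 1 ->
    normc (z * G t x) <= C' * decay x.
  move=> /GC[C' hC']; exists (normc z * C') => t x ht.
  by rewrite normcM -mulrA ler_wpM2l ?normc_ge0// hC'.
have ineta t : t \in `](- eta), (1 + eta)[ = (- eta < t < 1 + eta).
  by rewrite in_itv.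
have Re_part : \int[leb]_x complex.Re (H 0 x) = \int[leb]_x complex.Re (H 1 x).
  apply: (@shift_invariance R (fun t x => complex.Re (H t x))
    (fun t x => complex.Re (z * H t x)) (fun t x => complex.Re (z * G t x))
    eta C eta0).
  - by move=> t ht; have [] := mH t ht.
  - by move=> t x ht; exact: le_trans (normc_Re _) (HC t x ht).
  - by move=> x x0 t; rewrite ineta => ht; have [] := cdiff_continuous (cH t x x0 ht).
  - by move=> t x ht; have [] := dHt t x ht.
  - by move=> t x ht; have [] := dzH t x ht.
  - by move=> t ht x; have [] := cdiff_continuous (czG t x ht).
  - move=> t /zHC[C' hC']; exists C' => x.
    exact: le_trans (normc_Re _) (hC' x).
  - move=> e /zGC[C' hC']; exists C' => t x ht.
    exact: le_trans (normc_Re _) (hC' t x ht).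
have Im_part : \int[leb]_x complex.Im (H 0 x) = \int[leb]_x complex.Im (H 1 x).
  apply: (@shift_invariance R (fun t x => complex.Im (H t x))
    (fun t x => complex.Im (z * H t x)) (fun t x => complex.Im (z * G t x))
    eta C eta0).
  - by move=> t ht; have [] := mH t ht.
  - by move=> t x ht; exact: le_trans (normc_Im _) (HC t x ht).
  - by move=> x x0 t; rewrite ineta => ht; have [] := cdiff_continuous (cH t x x0 ht).
  - by move=> t x ht; have [] := dHt t x ht.
  - by move=> t x ht; have [] := dzH t x ht.
  - by move=> t ht x; have [] := cdiff_continuous (czG t x ht).
  - move=> t /zHC[C' hC']; exists C' => x.
    exact: le_trans (normc_Im _) (hC' x).
  - move=> e /zGC[C' hC']; exists C' => t x ht.
    exact: le_trans (normc_Im _) (hC' t x ht).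
by rewrite /integralC Re_part Im_part.
Qed.

End ContourShift.

Section KernelShift.
Variable R : realType.
Implicit Types (x y t : R).
Local Notation leb := (@lebesgue_measure R).
Variables (c sg : R) (s : R[i]).
Hypothesis sg0 : sg != 0.
Hypothesis sg_half : `|sg| < 2^-1.
Hypothesis c0 : 0 < c.
Hypothesis csg0 : 0 < c + sg.

(* The kernel is moved up by i t sg while the base of the power moves back by
   t sg.  With w = c + sg + i (y + i t sg), H is the value at y + i t sg of one
   holomorphic function, so its t-derivative is i sg times its y-derivative. *)
Let zeta t y : R[i] := y +i* (t * sg).
Let w t y : R[i] := (c + (1 - t) * sg) +i* y.
Let H t y : R[i] := kerX (zeta t y) * powH (w t y) s.
Let DH t y : R[i] := dkerX (zeta t y) * powH (w t y) s +
  kerX (zeta t y) * (s * ('i%C / w t y) * powH (w t y) s).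
Let v : R := Num.min c (c + sg) / 2.
(* eta is the room left for t beyond [0, 1]: the kernel must stay in
   |Im| <= 1/2 and the base of the power in Re >= v. *)
Let eta : R := Num.min v (2^-1 - `|sg|).

Let v0 : 0 < v.
Proof. by rewrite /v divr_gt0// lt_min c0. Qed.

Let eta0 : 0 < eta.
Proof. by rewrite /eta lt_min v0/= subr_gt0. Qed.

Let t_bound t : - eta < t < 1 + eta ->
  `|t * sg| <= 2^-1 /\ v <= c + (1 - t) * sg <= c + 1.
Proof.
move=> /andP[t1 t2].
have [h1 h2] : v + v <= c /\ v + v <= c + sg.
  have e : v + v = Num.min c (c + sg) by rewrite /v; field.
  by rewrite e; split; rewrite ge_min lexx ?orbT.
have [h3 h4] : eta <= v /\ eta <= 2^-1 - `|sg|.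
  by rewrite /eta; split; rewrite ge_min lexx ?orbT.
have [h5 h6] : sg <= `|sg| /\ - sg <= `|sg|.
  by rewrite ler_norm -normrN ler_norm.
have h7 := eta0; have h8 := v0.
have at1 : `|t| <= 1 + eta.
  by rewrite ler_norml; apply/andP; split; lra.
have h9 : eta * `|sg| <= eta / 2.
  by rewrite ler_wpM2l// ltW.
have h10 : `|t * sg| <= (1 + eta) * `|sg| by rewrite normrM ler_wpM2r.
have h11 : eta * sg <= eta * `|sg| by rewrite ler_wpM2l// ltW.
have h12 : eta * - sg <= eta * `|sg| by rewrite ler_wpM2l// ltW.
have [sgp|sgn] := lerP 0 sg.
  have k1 : (1 - t) * sg <= (1 + eta) * sg by rewrite ler_wpM2r//; lra.
  have k2 : - eta * sg <= (1 - t) * sg by rewrite ler_wpM2r//; lra.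
  have k3 := ger0_norm sgp.
  split; [|apply/andP; split]; lra.
have k1 : (1 - t) * - sg <= (1 + eta) * - sg by rewrite ler_wpM2r//; lra.
have k2 : - eta * - sg <= (1 - t) * - sg by rewrite ler_wpM2r//; lra.
have k3 := ltr0_norm sgn.
split; [|apply/andP; split]; lra.
Qed.

Let w_gt0 t y : - eta < t < 1 + eta -> 0 < complex.Re (w t y).
Proof. by move=> /t_bound[_ /andP[h _]]; exact: lt_le_trans v0 h. Qed.

Let wide t : 0 < t < 1 -> - eta < t < 1 + eta.
Proof. by have := eta0 => h /andP[? ?]; apply/andP; split; lra. Qed.

Let sinh_zeta_neq0 t y : - eta < t < 1 + eta -> zeta t y != 0 ->
  csinh (pi%:C * zeta t y) != 0.
Proof. by move=> /t_bound[h _] z0; apply: csinh_pi_neq0. Qed.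

Let zeta_neq0 t y : (y != 0) || (t != 0) -> zeta t y != 0.
Proof. by rewrite eq_complex /= negb_and mulf_eq0 negb_or sg0 andbT. Qed.

Let cderiv_zeta_t t y : cderiv (zeta^~ y) t (0 +i* sg).
Proof.
split; rewrite /zeta /=; first exact: is_derive_cst.
by apply: is_derive_eq; rewrite /GRing.scale/=; ring.
Qed.

Let cderiv_w_t t y : cderiv (w^~ y) t (- sg +i* 0).
Proof.
split; rewrite /w /=; last exact: is_derive_cst.
by apply: is_derive_eq; rewrite /GRing.scale/=; ring.
Qed.

Let cderiv_zeta_y t y : cderiv (zeta t) y 1.
Proof. by split; rewrite /zeta /=; [exact: is_derive_id|exact: is_derive_cst]. Qed.

Let cderiv_w_y t y : cderiv (w t) y 'i%C.
Proof. by split; rewrite /w /=; [exact: is_derive_cst|exact: is_derive_id]. Qed.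

Let isg : R[i] := 'i%C * sg%:C.

Let cderiv_H_t t y : - eta < t < 1 + eta -> zeta t y != 0 ->
  cderiv (H^~ y) t (isg * DH t y).
Proof.
move=> ht z0.
have d1 := @cderiv_kerX R (zeta^~ y) t _ (sinh_zeta_neq0 ht z0) (cderiv_zeta_t t y).
have d2 := @cderiv_powH R (w^~ y) s t _ (w_gt0 y ht) (cderiv_w_t t y).
apply: cderiv_eq (cderivM d1 d2) _.
rewrite /DH /isg.
have -> : 0 +i* sg = 'i%C * sg%:C :> R[i] by rewrite cplxE rmorph0 add0r.
have -> : - sg +i* 0 = 'i%C * 'i%C * sg%:C :> R[i].
  by rewrite -expr2 sqr_i mulN1r -rmorphN.
ring.
Qed.

Let cderiv_H_y t y : - eta < t < 1 + eta -> zeta t y != 0 ->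
  cderiv (H t) y (DH t y).
Proof.
move=> ht z0.
have d1 := cderiv_kerX (sinh_zeta_neq0 ht z0) (cderiv_zeta_y t y).
have d2 := cderiv_powH s (w_gt0 y ht) (cderiv_w_y t y).
by apply: cderiv_eq (cderivM d1 d2) _; rewrite /DH; ring.
Qed.

Let cdiff_DH t y : 0 < t < 1 -> cdiff (DH t) y.
Proof.
move=> ht; have ht' := wide ht.
have z0 : zeta t y != 0 by apply: zeta_neq0; case/andP: ht => t0 _; rewrite (gt_eqF t0) orbT.
have w0 := w_gt0 y ht'.
have wn0 : w t y != 0 by apply: contraTneq w0 => ->; rewrite /= ltxx.
have dz : cdiff (zeta t) y by eexists; exact: cderiv_zeta_y.
have dw : cdiff (w t) y by eexists; exact: cderiv_w_y.
have dp : cdiff (fun y => powH (w t y) s) y.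
  by eexists; exact: cderiv_powH w0 (cderiv_w_y t y).
have dk : cdiff (fun y => kerX (zeta t y)) y.
  by eexists; exact: cderiv_kerX (sinh_zeta_neq0 ht' z0) (cderiv_zeta_y t y).
rewrite /DH; apply: cdiffD; apply: cdiffM => //.
  by apply: cdiff_dkerX => //; exact: sinh_zeta_neq0.
apply: cdiffM => //; apply: cdiffM; first exact: cdiff_cst.
by apply: cdiffM; [exact: cdiff_cst|exact: cdiffV].
Qed.

Let pow_bound : exists2 C, 0 < C & forall t y, - eta < t < 1 + eta ->
  normc (powH (w t y) s) <= C * expR (`|y| / 2).
Proof.
have [C C0 hC] := @normc_powH_bound R s v (c + 1) v0.
by exists C => // t y /t_bound[_ h]; exact: hC.
Qed.

Let decayE y : expR (- `|y|) * expR (`|y| / 2) = decay y.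
Proof. by rewrite -expRD; congr expR; field. Qed.

Let mul_bound (C C' : R) (z z' : R[i]) y : 0 < C ->
  normc z <= C * expR (- `|y|) -> normc z' <= C' * expR (`|y| / 2) ->
  normc (z * z') <= C * C' * decay y.
Proof.
move=> C0 h h'; rewrite normcM -decayE mulrACA.
by apply: ler_pM; rewrite ?normc_ge0.
Qed.

Let H_bound : exists2 C, 0 < C & forall t y, - eta < t < 1 + eta ->
  normc (H t y) <= C * decay y.
Proof.
have [Ck Ck0 hk] := @normc_kerX_le R; have [Cp Cp0 hp] := pow_bound.
exists (Ck * Cp); first exact: mulr_gt0.
move=> t y ht; apply: mul_bound => //; last exact: hp.
by have [h _] := t_bound ht; apply: hk.
Qed.

Let DH_bound e : 0 < e -> exists C, forall t y, e < t < 1 ->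
  normc (DH t y) <= C * decay y.
Proof.
move=> e0.
have [Ck Ck0 hk] := @normc_kerX_le R; have [Cp Cp0 hp] := pow_bound.
have d0 : 0 < e * `|sg| by rewrite mulr_gt0// normr_gt0.
have [Cd Cd0 hd] := normc_dkerX_le d0.
exists (Cd * Cp + Ck * (normc s / v * Cp)) => t y /andP[t1 t2].
have ht : - eta < t < 1 + eta by apply: wide; rewrite t2 (lt_trans e0).
have [h1 /andP[h2 _]] := t_bound ht.
rewrite (le_trans (normc_leD _ _))// [leRHS]mulrDl; apply: lerD.
  apply: mul_bound => //; last exact: hp.
  apply: (hd (zeta t y)); rewrite h1 andbT /= normrM ler_wpM2r//.
  by rewrite ger0_norm ?ltW// (lt_trans e0).
apply: mul_bound => //; first exact: hk.
rewrite normcM -(mulrA (normc s / v)); apply: ler_pM; rewrite ?normc_ge0//; last exact: hp.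
rewrite !normcM normci mul1r normcV ler_wpM2l ?normc_ge0//.
have h3 : v <= normc (w t y).
  by apply: le_trans (normc_Re _); rewrite (le_trans h2)// ler_norm.
by rewrite lef_pV2 ?posrE ?(lt_le_trans v0 h3).
Qed.

Let cmeas_H t : cmeas (H t).
Proof.
apply: cmeasM; first by apply: cmeas_kerX; apply: cmeas_pair.
by apply: cmeas_powH; apply: cmeas_pair.
Qed.

Lemma kernel_shift_neq0 :
  integralC leb (fun x => kerX x%:C * powH ((c + sg) +i* x) s) =
  integralC leb (fun y => kerX (y +i* sg) * powH (c +i* y) s).
Proof.
have -> : (fun x => kerX x%:C * powH ((c + sg) +i* x) s) = H 0.
  by apply/funext => x; rewrite /H /zeta /w mul0r subr0 mul1r.
have -> : (fun y => kerX (y +i* sg) * powH (c +i* y) s) = H 1.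
  by apply/funext => x; rewrite /H /zeta /w mul1r subrr mul0r addr0.
have in01 t y : 0 < t < 1 -> zeta t y != 0.
  by move=> /andP[t0 _]; apply: zeta_neq0; rewrite (gt_eqF t0) orbT.
have [C C0 hC] := H_bound.
apply: (@contour_shift R H DH isg eta C eta0).
- by move=> t _; exact: cmeas_H.
- exact: hC.
- move=> t x x0 ht; eexists; apply: cderiv_H_t => //.
  by apply: zeta_neq0; rewrite x0.
- by move=> t x ht; apply: cderiv_H_t; [exact: wide|exact: in01].
- by move=> t x ht; apply: cderiv_H_y; [exact: wide|exact: in01].
- exact: cdiff_DH.
- exact: DH_bound.
Qed.

End KernelShift.

(** Cauchy's theorem for k(z) (c + sg + i z)^s between the lines Im z = 0 and
    Im z = sg. *)
Lemma kernel_shift (R : realType) (c sg : R) (s : R[i]) :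
  `|sg| < 2^-1 -> 0 < c -> 0 < c + sg ->
  integralC (@lebesgue_measure R)
    (fun x => kerX x%:C * powH ((c + sg) +i* x) s) =
  integralC (@lebesgue_measure R)
    (fun y => kerX (y +i* sg) * powH (c +i* y) s).
Proof.
have [->|] := eqVneq sg 0; last exact: kernel_shift_neq0.
by rewrite addr0.
Qed.

(** * Integration of the kernel across the strip *)

Section InnerIntegral.
Variable R : realType.
Implicit Types (x y t u : R) (z l : R[i]).
Local Notation leb := (@lebesgue_measure R).

(** z coth (pi z), a second antiderivative of 2 kerX. *)
Definition prim2 z : R[i] :=
  z * (ccosh (pi%:C * z) * (csinh (pi%:C * z))^-1).

(** The derivative of prim2, an antiderivative of 2 kerX. *)
Definition prim1 z : R[i] :=
  ccosh (pi%:C * z) * (csinh (pi%:C * z))^-1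
  - pi%:C * z * ((csinh (pi%:C * z))^-1 * (csinh (pi%:C * z))^-1).

Lemma cderiv_prim2 (f : R -> R[i]) x l : csinh (pi%:C * f x) != 0 ->
  cderiv f x l -> cderiv (fun t => prim2 (f t)) x (l * prim1 (f x)).
Proof.
move=> s0 df; have dq := cderivMl pi%:C df.
have dS := cderivV s0 (cderiv_csinh dq).
have dC := cderiv_ccosh dq.
apply: cderiv_eq (cderivM df (cderivM dC dS)) _.
cbv beta; rewrite /prim1.
have c2 : ccosh (pi%:C * f x) ^+ 2 = csinh (pi%:C * f x) ^+ 2 + 1.
  by rewrite -(cosh2_sinh2 (pi%:C * f x)) addrC subrK.
move: c2 s0; move: (ccosh _) (csinh _) => c s c2 s0.
apply/eqP; rewrite -subr_eq0.
set e := _ - _.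
have -> : e = - l * pi%:C * f x * (c ^+ 2 - s ^+ 2 - 1) / s ^+ 2.
  by rewrite /e; field.
by rewrite c2 [_ + 1]addrC addrK subrr mulr0 mul0r.
Qed.

Lemma cderiv_prim1 (f : R -> R[i]) x l : csinh (pi%:C * f x) != 0 ->
  cderiv f x l -> cderiv (fun t => prim1 (f t)) x (l * (2%:R * kerX (f x))).
Proof.
move=> s0 df; have dq := cderivMl pi%:C df.
have dS := cderivV s0 (cderiv_csinh dq).
have dC := cderiv_ccosh dq.
apply: cderiv_eq (cderivB (cderivM dC dS) (cderivM dq (cderivM dS dS))) _.
cbv beta; rewrite /kerX.
have c2 : ccosh (pi%:C * f x) ^+ 2 = csinh (pi%:C * f x) ^+ 2 + 1.
  by rewrite -(cosh2_sinh2 (pi%:C * f x)) addrC subrK.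
move: c2 s0; move: (ccosh _) (csinh _) => c s c2 s0.
apply/eqP; rewrite -subr_eq0.
set e := _ - _.
have -> : e = - l * pi%:C * (c ^+ 2 - s ^+ 2 - 1) / s ^+ 2.
  by rewrite /e; field.
by rewrite c2 [_ + 1]addrC addrK subrr mulr0 mul0r.
Qed.

Lemma expC_half_pi : expC ('i%C * (pi / 2)%:C) = 'i%C :> R[i].
Proof.
have -> : 'i%C * (pi / 2)%:C = 0 +i* (pi / 2) :> R[i] by rewrite [RHS]cplxE rmorph0 add0r.
by rewrite /expC/= expR0 cos_pihalf sin_pihalf !mul1r.
Qed.

Lemma expC_half_piN : expC (- ('i%C * (pi / 2)%:C)) = - 'i%C :> R[i].
Proof.
have -> : - ('i%C * (pi / 2)%:C) = 0 +i* (- (pi / 2)) :> R[i].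
  by rewrite [RHS]cplxE rmorph0 add0r rmorphN mulrN.
rewrite /expC/= expR0 cosN sinN cos_pihalf sin_pihalf !mul1r.
by apply: eq_cplx => //=; rewrite oppr0.
Qed.

Definition half_i : R[i] := 'i%C / 2%:R.

Let pi_half_i : pi%:C * half_i = 'i%C * (pi / 2)%:C.
Proof.
by rewrite /half_i rmorphM fmorphV [in RHS]rmorph_nat; ring.
Qed.

(** A shift by i/2 exchanges sinh and cosh up to a factor: this is what
    replaces the kernel of X by the weight 1 / cosh^2 (pi y). *)
Lemma csinh_shift_half z : csinh (pi%:C * (z + half_i)) = 'i%C * ccosh (pi%:C * z).
Proof.
rewrite mulrDr pi_half_i /csinh /ccosh opprD !expCD expC_half_pi expC_half_piN.
ring.
Qed.

Lemma ccosh_shift_half z : ccosh (pi%:C * (z + half_i)) = 'i%C * csinh (pi%:C * z).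
Proof.
rewrite mulrDr pi_half_i /csinh /ccosh opprD !expCD expC_half_pi expC_half_piN.
ring.
Qed.

Lemma ccoshN z : ccosh (- z) = ccosh z.
Proof. by rewrite /ccosh opprK addrC. Qed.

Lemma csinh_shift_halfN z :
  csinh (pi%:C * (z - half_i)) = - ('i%C * ccosh (pi%:C * z)).
Proof.
by rewrite -opprB mulrN csinhN addrC csinh_shift_half mulrN ccoshN.
Qed.

Lemma ccosh_shift_halfN z :
  ccosh (pi%:C * (z - half_i)) = - ('i%C * csinh (pi%:C * z)).
Proof.
by rewrite -opprB mulrN ccoshN addrC ccosh_shift_half mulrN csinhN mulrN.
Qed.

(* Integration by parts of (a - u) kerX (z u), with z u = y + i (u - 1/2) and
   z' = i: each antiderivative costs a factor 1 / i = - i. *)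
Let W a y u : R[i] :=
  - (half_i * ((a - u)%:C * prim1 (y +i* (u - 2^-1))))
  - 2%:R^-1 * prim2 (y +i* (u - 2^-1)).

Let seg u : 0 <= u <= 1 -> `|u - 2^-1| <= 2^-1 :> R.
Proof. by move=> /andP[u0 u1]; rewrite ler_norml; apply/andP; split; lra. Qed.

Let seg_neq0 y u : y != 0 -> y +i* (u - 2^-1) != 0 :> R[i].
Proof. by move=> y0; rewrite eq_complex /= (negbTE y0). Qed.

Let is_derive_subr (b u : R) : is_derive u 1 (fun u => u - b) 1.
Proof. by apply: is_derive_eq; ring. Qed.

Let is_derive_rsub (b u : R) : is_derive u 1 (fun u => b - u) (-1).
Proof. by apply: is_derive_eq; ring. Qed.

Let cderiv_seg y u : cderiv (fun u => y +i* (u - 2^-1)) u 'i%C.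
Proof.
by split => /=; [exact: is_derive_cst|exact: is_derive_subr].
Qed.

Let cderiv_W a y u : y != 0 -> 0 <= u <= 1 ->
  cderiv (W a y) u ((a - u)%:C * kerX (y +i* (u - 2^-1))).
Proof.
move=> y0 hu.
have s0 : csinh (pi%:C * (y +i* (u - 2^-1))) != 0.
  by apply: csinh_pi_neq0; [exact: seg_neq0|exact: seg].
have d1 := @cderiv_prim1 (fun u => y +i* (u - 2^-1)) u _ s0 (cderiv_seg y u).
have d2 := @cderiv_prim2 (fun u => y +i* (u - 2^-1)) u _ s0 (cderiv_seg y u).
have d0 : cderiv (fun u => (a - u)%:C) u (-1)%:C.
  by apply: cderiv_R; exact: is_derive_rsub.
apply: cderiv_eq (cderivB (cderivN (cderivMl half_i (cderivM d0 d1))) (cderivMl 2%:R^-1 d2)) _.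
cbv beta; rewrite /half_i rmorphN rmorph1.
rewrite [RHS](_ : _ =
  - 'i%C ^+ 2 * ((a - u)%:C * kerX (y +i* (u - 2^-1)))); last first.
  by rewrite sqr_i opprK mul1r.
move: (prim1 _) (kerX _) (_%:C) ('i%C : R[i]) => p k b I.
by field; rewrite ?pnatr_eq0.
Qed.

Lemma unit_interval_FTC (w g : R -> R) :
  (forall u, 0 <= u <= 1 -> is_derive u 1 w (g u)) ->
  (forall u, 0 <= u <= 1 -> {for u, continuous g}) ->
  \int[leb]_u (if 0 < u < 1 then g u else 0) = w 1 - w 0.
Proof.
move=> dw cg.
have cw u : 0 <= u <= 1 -> {for u, continuous w}.
  by move=> hu; apply/differentiable_continuous/derivable1_diffP; have [] := dw u hu.
have oo u : u \in `]0, 1[ -> 0 <= u <= 1.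
  by rewrite in_itv/= => /andP[? ?]; apply/andP; split; lra.
have mg : measurable_fun (`]0, 1[%classic : set R) g.
  apply: open_continuous_measurable_fun; first exact: interval_open.
  by move=> u; rewrite inE => /oo; exact: cg.
rewrite /Rintegral.
have -> : (\int[leb]_u (if (0 < u < 1)%R then g u else 0%R)%:E
    = \int[leb]_(u in `]0%R, 1%R[) (g u)%:E)%E.
  rewrite [RHS]integral_mkcond; apply: eq_integral => u _.
  by rewrite patchE mem_setE in_itv/=; case: ifP.
rewrite -(@integral_itv_bndoo R 0 1 _ true false); last exact/measurable_EFinP.
rewrite (@continuous_FTC2 R g w 0 1 ltr01)//.
- apply: continuous_in_subspaceT => u; rewrite inE/= in_itv/=; exact: cg.
- split.
  + by move=> u /oo hu; have [] := dw u hu.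
  + by apply: cvg_at_right_filter; apply: cw; rewrite lexx ler01.
  + by apply: cvg_at_left_filter; apply: cw; rewrite lexx ler01.
- by move=> u /oo hu; rewrite derive1E; have [] := dw u hu.
Qed.

(** The boundary terms of the integration by parts at u = 1 and u = 0, that is
    at y + i/2 and y - i/2.  The tanh terms cancel, since
    (i/2) (a - (a - 1)) tanh (pi y) from the coth terms meets
    - (1/2) ((y + i/2) - (y - i/2)) tanh (pi y); only the 1 / sinh^2 terms, now
    1 / cosh^2, remain.  The point y = 0 is excluded because there the segment
    meets the value 0 given by convention to the kernel at its removable
    singularity. *)
Lemma inner_integral (a y : R) : y != 0 ->
  integralC leb (fun u => (if 0 < u < 1 then a - u else 0)%:C *
                          kerX (y +i* (u - 2^-1))) =
  (2^-1 * pi)%:C * ((a - 2^-1) +i* y) / ccosh (pi%:C * y%:C) ^+ 2.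
Proof.
move=> y0.
pose G u : R[i] := (a - u)%:C * kerX (y +i* (u - 2^-1)).
have dG u : 0 <= u <= 1 -> cdiff G u.
  move=> hu; apply: cdiffM.
    eexists; apply: cderiv_R; exact: is_derive_rsub.
  have s0 : csinh (pi%:C * (y +i* (u - 2^-1))) != 0.
    by apply: csinh_pi_neq0; [exact: seg_neq0|exact: seg].
  eexists; exact: (@cderiv_kerX R (fun u => y +i* (u - 2^-1)) u _ s0 (cderiv_seg y u)).
have dW u hu := @cderiv_W a y u y0 hu.
have -> : (fun u => (if 0 < u < 1 then a - u else 0)%:C * kerX (y +i* (u - 2^-1))) =
    (fun u => (if 0 < u < 1 then complex.Re (G u) else 0) +i*
              (if 0 < u < 1 then complex.Im (G u) else 0)).
  by apply/funext => u; case: ifP => _; [apply: eq_cplx|rewrite rmorph0 mul0r].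
have -> : integralC leb (fun u => (if 0 < u < 1 then complex.Re (G u) else 0) +i*
              (if 0 < u < 1 then complex.Im (G u) else 0)) = W a y 1 - W a y 0.
  apply: eq_cplx; rewrite ?(cReD, cImD, cReN, cImN).
  - exact: (@unit_interval_FTC (fun u => complex.Re (W a y u)) (fun u => complex.Re (G u))
      (fun u hu => (dW u hu).1) (fun u hu => (cdiff_continuous (dG u hu)).1)).
  - exact: (@unit_interval_FTC (fun u => complex.Im (W a y u)) (fun u => complex.Im (G u))
      (fun u hu => (dW u hu).2) (fun u hu => (cdiff_continuous (dG u hu)).2)).
rewrite /W.
have E1 : y +i* (1 - 2^-1) = y%:C + half_i.
  apply: eq_cplx; rewrite /half_i natC -fmorphV /= ?mul0r ?mul1r ?mulr0 ?subr0 ?addr0 ?add0r//.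
  by field.
have E0 : y +i* (0 - 2^-1) = y%:C - half_i.
  by apply: eq_cplx; rewrite /half_i natC -fmorphV /= ?mul0r ?mul1r ?mulr0 ?subr0 ?addr0 ?add0r// ?oppr0 ?addr0.
rewrite E1 E0 /prim1 /prim2 csinh_shift_half ccosh_shift_half.
rewrite csinh_shift_halfN ccosh_shift_halfN.
have Ey : (a - 2^-1) +i* y = a%:C - 2%:R^-1 + 'i%C * y%:C.
  by rewrite cplxE rmorphB fmorphV (rmorph_nat (real_complex R)).
have c0 : ccosh (pi%:C * y%:C) != 0.
  rewrite -rmorphM ccoshR (fmorph_eq0 (real_complex R)) gt_eqF//.
  by apply: lt_le_trans (cosh_ge _); rewrite divr_gt0 ?expR_gt0.
have Ea : (a - 1)%:C = a%:C - 1 :> R[i] by rewrite rmorphB rmorph1.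
have Ep : (2^-1 * pi)%:C = 2%:R^-1 * pi%:C :> R[i].
  by rewrite rmorphM fmorphV (rmorph_nat (real_complex R)).
rewrite Ey Ep Ea subr0 /half_i.
have i2 : 'i%C ^+ 2 = -1 :> R[i] := sqr_i R.
have i0 : 'i%C != 0 :> R[i].
  by rewrite eq_complex /= negb_and oner_eq0 orbT.
move: i2 i0 c0; move: (ccosh _) (csinh _) ('i%C : R[i]).
move=> c sh I i2 i0 c0.
have SS : (I * c)^-1 * (I * c)^-1 = - (c^-1 * c^-1).
  by rewrite invfM mulrACA -invfM -expr2 i2 invrN1 mulN1r.
have SSN : (- (I * c))^-1 * (- (I * c))^-1 = - (c^-1 * c^-1).
  by rewrite invrN mulrNN SS.
have Ct : I * sh * (I * c)^-1 = sh / c by field; rewrite ?c0 ?i0.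
have CtN : - (I * sh) * (- (I * c))^-1 = sh / c by field; rewrite ?c0 ?i0.
rewrite SS SSN Ct CtN.
apply/eqP; rewrite -subr_eq0; set e := _ - _.
have -> : e = - pi%:C * (a%:C - 2%:R^-1) / (2%:R * c ^+ 2) * (I ^+ 2 + 1).
  by rewrite /e; field; rewrite ?pnatr_eq0.
by rewrite i2 addNr mulr0.
Qed.

End InnerIntegral.

(** * Complex-valued integrals *)

Section ComplexIntegralTheory.
Context (R : realType) (d : measure_display) (T : measurableType d).
Variable mu : {measure set T -> \bar R}.
Implicit Types (f g : T -> R[i]).

Lemma integrableC_le f (g : T -> R) : cmeas f ->
  mu.-integrable setT (EFin \o g) -> (forall t, normc (f t) <= g t) ->
  integrableC mu f.
Proof.
move=> [f1 f2] ig fg; split.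
- apply: (le_integrable measurableT _ _ ig); first exact/measurable_EFinP.
  move=> t _ /=; rewrite lee_fin (le_trans (normc_Re _))// (le_trans (fg t))//.
  exact: ler_norm.
- apply: (le_integrable measurableT _ _ ig); first exact/measurable_EFinP.
  move=> t _ /=; rewrite lee_fin (le_trans (normc_Im _))// (le_trans (fg t))//.
  exact: ler_norm.
Qed.

Lemma integrableC_cmeas f : integrableC mu f -> cmeas f.
Proof.
by move=> [i1 i2]; split; apply/measurable_EFinP; [exact: measurable_int i1|
  exact: measurable_int i2].
Qed.

Lemma integrable_normc f : integrableC mu f ->
  mu.-integrable setT (EFin \o (fun t => normc (f t))).
Proof.
move=> fi; have [i1 i2] := fi.
have ii := integrableD measurableT (integrable_abse i1) (integrable_abse i2).
apply: (le_integrable measurableT _ _ ii).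
  by apply/measurable_EFinP; apply: measurable_normc; exact: integrableC_cmeas.
move=> t _ /=; rewrite lee_fin (ger0_norm (normc_ge0 _)) (ger0_norm (addr_ge0 _ _))//.
exact: normc_le_ReIm.
Qed.

Let integrable_scale (c : R) (h : T -> R) : mu.-integrable setT (EFin \o h) ->
  mu.-integrable setT (EFin \o (fun t => c * h t)).
Proof.
by move=> ih; rewrite /comp; under eq_fun do rewrite EFinM; exact: integrableZl.
Qed.

Lemma integrableC_cZ (z : R[i]) f : integrableC mu f ->
  integrableC mu (fun t => z * f t).
Proof.
move=> fi; apply: (@integrableC_le _ (fun t => normc z * normc (f t))).
- apply: cmeasM; first exact: cmeas_cst.
  exact: integrableC_cmeas fi.
- rewrite /comp; under eq_fun do rewrite EFinM.
  exact: integrableZl (integrable_normc fi).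
- by move=> t; rewrite normcM.
Qed.

Lemma integralC_cZ (z : R[i]) f : integrableC mu f ->
  integralC mu (fun t => z * f t) = z * integralC mu f.
Proof.
move=> [i1 i2]; rewrite /integralC; apply: eq_cplx; rewrite ?cReM ?cImM /=.
- under eq_Rintegral do rewrite cReM.
  rewrite RintegralB//; [|exact: integrable_scale..].
  by rewrite !RintegralZl.
- under eq_Rintegral do rewrite cImM.
  rewrite RintegralD//; [|exact: integrable_scale..].
  by rewrite !RintegralZl.
Qed.

Lemma integralCD f g : integrableC mu f -> integrableC mu g ->
  integralC mu (fun t => f t + g t) = integralC mu f + integralC mu g.
Proof.
move=> [f1 f2] [g1 g2]; rewrite /integralC; apply: eq_cplx; rewrite ?cReD ?cImD /=.
- by under eq_Rintegral do rewrite cReD; rewrite RintegralD.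
- by under eq_Rintegral do rewrite cImD; rewrite RintegralD.
Qed.

Lemma integralCB f g : integrableC mu f -> integrableC mu g ->
  integralC mu (fun t => f t - g t) = integralC mu f - integralC mu g.
Proof.
move=> [f1 f2] [g1 g2]; rewrite /integralC; apply: eq_cplx;
  rewrite ?cReD ?cImD ?cReN ?cImN /=.
- under eq_Rintegral do rewrite cReD cReN; by rewrite RintegralB.
- under eq_Rintegral do rewrite cImD cImN; by rewrite RintegralB.
Qed.

Lemma integrableCD f g : integrableC mu f -> integrableC mu g ->
  integrableC mu (fun t => f t + g t).
Proof.
move=> fi gi.
apply: (@integrableC_le _ (fun t => normc (f t) + normc (g t))).
- by apply: cmeasD; exact: integrableC_cmeas.
- rewrite /comp; under eq_fun do rewrite EFinD.
  exact: integrableD (integrable_normc fi) (integrable_normc gi).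
- by move=> t; exact: normc_leD.
Qed.

Lemma integrableCB f g : integrableC mu f -> integrableC mu g ->
  integrableC mu (fun t => f t - g t).
Proof.
move=> fi gi.
apply: (@integrableC_le _ (fun t => normc (f t) + normc (g t))).
- by apply: cmeasB; exact: integrableC_cmeas.
- rewrite /comp; under eq_fun do rewrite EFinD.
  exact: integrableD (integrable_normc fi) (integrable_normc gi).
- by move=> t; exact: normc_leB.
Qed.

(** The factor 2, from bounding the real and imaginary parts separately, is
    harmless in the estimates that use it. *)
Lemma normc_integralC_le f (g : T -> R) : cmeas f ->
  mu.-integrable setT (EFin \o g) -> (forall t, normc (f t) <= g t) ->
  normc (integralC mu f) <= 2 * \int[mu]_t g t.
Proof.
move=> mf ig fg; have [i1 i2] := integrableC_le mf ig fg.
rewrite (le_trans (normc_le_ReIm _))// mulr_natl mulr2n /=.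
by apply: lerD; rewrite (le_trans (le_normr_Rintegral _ _))//;
  apply: le_Rintegral => //; try exact: (integrable_abse i1);
  try exact: (integrable_abse i2); move=> t _;
  rewrite (le_trans _ (fg t))// ?normc_Re ?normc_Im.
Qed.

Lemma ae_eq_integralC f g : cmeas f -> cmeas g ->
  {ae mu, forall t, f t = g t} -> integralC mu f = integralC mu g.
Proof.
move=> [f1 f2] [g1 g2] fg; rewrite /integralC /Rintegral; congr (fine _ +i* fine _).
- apply: ae_eq_integral => //; [exact/measurable_EFinP|exact/measurable_EFinP|].
  by apply: filterS fg => t -> _.
- apply: ae_eq_integral => //; [exact/measurable_EFinP|exact/measurable_EFinP|].
  by apply: filterS fg => t -> _.
Qed.

End ComplexIntegralTheory.

Section ComplexFubini.
Context (R : realType) (d1 d2 : measure_display).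
Context (T1 : measurableType d1) (T2 : measurableType d2).
Variable m1 : {sigma_finite_measure set T1 -> \bar R}.
Variable m2 : {sigma_finite_measure set T2 -> \bar R}.

(** The inner real-valued integrals agree only almost everywhere with the
    extended ones, namely where they are finite. *)
Lemma Rintegral_fubini1 (f : T1 * T2 -> R) :
  (m1 \x m2)%E.-integrable setT (EFin \o f) ->
  \int[m1]_x \int[m2]_y f (x, y) = \int[(m1 \x m2)%E]_z f z.
Proof.
move=> fi; rewrite /Rintegral -(integral12_prod_meas1 fi); congr fine.
have mF := measurable_fubini_F fi; have iF := integrable_fubini_F fi.
apply: ae_eq_integral => //.
  apply/measurable_EFinP; apply: measurableT_comp mF; exact: fine_measurable.
have := integrable_ae measurableT iF; apply: filterS => x /= h _.
by rewrite fineK//; exact: h.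
Qed.

Lemma Rintegral_fubini2 (f : T1 * T2 -> R) :
  (m1 \x m2)%E.-integrable setT (EFin \o f) ->
  \int[m2]_y \int[m1]_x f (x, y) = \int[(m1 \x m2)%E]_z f z.
Proof.
move=> fi; rewrite /Rintegral -(integral21_prod_meas1 fi); congr fine.
have mG := measurable_fubini_G fi.
apply: ae_eq_integral => //.
  apply/measurable_EFinP; apply: measurableT_comp mG; exact: fine_measurable.
have := ae_integrable2 fi; apply: filterS => x /= h _.
by rewrite fineK//; exact: integrable_fin_num.
Qed.

Lemma integralC_fubini1 (f : T1 * T2 -> R[i]) :
  integrableC (m1 \x m2)%E f ->
  integralC m1 (fun x => integralC m2 (fun y => f (x, y))) =
  integralC (m1 \x m2)%E f.
Proof.
by move=> [i1 i2]; rewrite /integralC /= -(Rintegral_fubini1 i1) -(Rintegral_fubini1 i2).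
Qed.

Lemma integralC_fubini2 (f : T1 * T2 -> R[i]) :
  integrableC (m1 \x m2)%E f ->
  integralC m2 (fun y => integralC m1 (fun x => f (x, y))) =
  integralC (m1 \x m2)%E f.
Proof.
by move=> [i1 i2]; rewrite /integralC /= -(Rintegral_fubini2 i1) -(Rintegral_fubini2 i2).
Qed.

Lemma cmeas_fubini2 (f : T1 * T2 -> R[i]) : integrableC (m1 \x m2)%E f ->
  cmeas (fun y => integralC m1 (fun x => f (x, y))).
Proof.
move=> [i1 i2]; split; rewrite /integralC /=.
- have mG := measurable_fubini_G i1.
  by have := measurableT_comp (@fine_measurable R setT measurableT) mG.
- have mG := measurable_fubini_G i2.
  by have := measurableT_comp (@fine_measurable R setT measurableT) mG.
Qed.

End ComplexFubini.

(** * Power singularities *)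

Section PowerSingularity.
Variable R : realType.
Implicit Types (x y t u q a : R).
Local Notation leb := (@lebesgue_measure R).

(** |x|^(-q), with the value 1 at 0. *)
Definition sing q x : R := expR (- (q * ln `|x|)).

Lemma sing_ge0 q x : 0 <= sing q x. Proof. exact: expR_ge0. Qed.

Lemma measurable_sing q : measurable_fun [set: R] (sing q).
Proof.
apply: (measurableT_comp (@measurable_expR R)); apply: measurable_funN.
apply: measurable_funM => //.
exact: (measurableT_comp (@measurable_ln R)).
Qed.

Lemma sing0 x : sing 0 x = 1.
Proof. by rewrite /sing mul0r oppr0 expR0. Qed.

Lemma singN q x : sing q (- x) = sing q x.
Proof. by rewrite /sing normrN. Qed.

Lemma sing_le1 q x : 0 <= q -> 1 <= `|x| -> sing q x <= 1.
Proof. by move=> q0 x1; rewrite expR_le1 oppr_le0 mulr_ge0// ln_ge0. Qed.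

(** For a = 1 and Re s < 1 the base tends to 0 at u = x = 0, and
    (a - 1 + u)^2 + x^2 >= u^2 + x^2 >= 2 u |x| bounds the power of the modulus
    by a product of powers of u and |x| with exponent (Re s - 1) / 2, which is
    larger than -1 as long as Re s > -1.  In the other cases q = 0 will do: the
    base stays away from 0, or the exponent is nonnegative and the modulus can
    be increased to that of a + i x. *)
Lemma powH_singularity_bound (s : R[i]) a : 1 <= a ->
  1 < a \/ -1 < complex.Re s ->
  exists q C, [/\ 0 <= q < 1, 0 < C & forall u x, 0 < u < 1 -> x != 0 ->
  normc (powH ((a - 1 + u) +i* x) (s - 1)) <=
  C * (sing q u * sing q x) * expR (`|x| / 2)].
Proof.
move=> a1 [{}a1|s1].
  have v0 : 0 < a - 1 by rewrite subr_gt0.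
  have [C C0 hC] := @normc_powH_bound R (s - 1) (a - 1) a v0.
  exists 0, C; split => //; first by rewrite lexx ltr01.
  move=> u x /andP[u0 u1] _; rewrite !sing0 !mulr1.
  by apply: (hC ((a - 1 + u) +i* x)); apply/andP; split => /=; lra.
pose al := complex.Re (s - 1).
have alE : al = complex.Re s - 1 by rewrite /al cReD cReN.
pose D := expR (pi * `|complex.Im (s - 1)|).
have D0 : 0 < D := expR_gt0 _.
have a0 : 0 < a by lra.
have [al0|al0] := lerP 0 al.
  have [C C0 hC] := @log_modulus_bound R al a a al0 a0.
  exists 0, (D * C); split => //; [by rewrite lexx ltr01|exact: mulr_gt0|].
  move=> u x /andP[u0 u1] _; rewrite !sing0 !mulr1.
  apply: (le_trans (normc_powH_le _ _)); rewrite -mulrA ler_wpM2l ?(ltW D0)//.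
  have := hC (a +i* x); rewrite /= !lexx => /(_ erefl); apply: le_trans.
  rewrite ler_expR -/al ler_wpM2l// (le_trans _ (ler_norm _))//.
  rewrite ler_pM2r ?invr_gt0//.
  have h1 : 0 < a - 1 + u by lra.
  rewrite ler_ln ?posrE ?ltr_pwDl ?exprn_gt0 ?sqr_ge0//.
  by rewrite lerD2r ler_sqr ?nnegrE ?(ltW h1) ?(ltW a0)//; lra.
exists (- al / 2), D; split => //; first by apply/andP; split; lra.
move=> u x /andP[u0 u1] x0.
apply: (le_trans (normc_powH_le _ _)); rewrite -mulrA ler_wpM2l ?(ltW D0)//.
have e1 : 1 <= expR (`|x| / 2) by rewrite -(expR0 R) ler_expR divr_ge0.
rewrite -[leLHS]mulr1; apply: ler_pM => //.
rewrite /sing -expRD ler_expR -/al (gtr0_norm u0).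
have x0' : 0 < `|x| by rewrite normr_gt0.
have -> : - (- al / 2 * ln u) - - al / 2 * ln `|x| = al * (ln (u * `|x|) / 2).
  by rewrite lnM ?posrE//; ring.
rewrite ler_wnM2l ?(ltW al0)// ler_pM2r ?invr_gt0//=.
have h1 : 0 < a - 1 + u by lra.
rewrite ler_ln ?posrE ?mulr_gt0 ?ltr_pwDl ?exprn_gt0 ?sqr_ge0//.
have -> : x ^+ 2 = `|x| ^+ 2 by rewrite real_normK ?num_real.
have : u ^+ 2 <= (a - 1 + u) ^+ 2.
  by rewrite ler_sqr ?nnegrE ?(ltW h1) ?(ltW u0)//; lra.
have := sqr_ge0 (u - `|x|); have := mulr_gt0 u0 x0'.
by move: `|x| => y; rewrite sqrrB; lra.
Qed.

Lemma is_derive_sing_prim q u : q < 1 -> 0 < u ->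
  is_derive u 1 (fun u => expR ((1 - q) * ln u) / (1 - q)) (sing q u).
Proof.
move=> q1 u0.
have d1 : is_derive u 1 (fun u => (1 - q) * ln u) ((1 - q) * u^-1).
  have d := is_derive1_ln u0.
  by apply: is_derive_eq; rewrite /GRing.scale/=; ring.
have d2 := @is_derive1_comp R expR _ u _ _ (is_derive_expR _) d1.
apply: is_derive_eq.
rewrite /GRing.scale/= /sing gtr0_norm//.
have -> : expR ((1 - q) * ln u) = u * expR (- (q * ln u)).
  by rewrite mulrBl mul1r expRD lnK ?posrE.
by field; rewrite gt_eqF//= gt_eqF// subr_gt0.
Qed.

Lemma continuous_sing q u : 0 < u -> {for u, continuous (sing q)}.
Proof.
move=> u0; apply: continuous_comp; last exact: continuous_expR.
apply: cvgN; apply: cvgMl_tmp.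
apply: continuous_comp; first exact: norm_continuous.
by apply: continuous_ln; rewrite normr_gt0 gt_eqF.
Qed.

Lemma integral_sing_le q e : 0 <= q < 1 -> 0 < e < 1 ->
  (\int[leb]_(x in `[e, 1%R]) (sing q x)%:E <= ((1 - q)^-1)%:E)%E.
Proof.
move=> /andP[q0 q1] /andP[e0 e1].
have pos u : e <= u -> 0 < u by exact: lt_le_trans.
pose F u : R := expR ((1 - q) * ln u) / (1 - q).
have dF u : 0 < u -> is_derive u 1 F (sing q u) by exact: is_derive_sing_prim.
have cF u : 0 < u -> {for u, continuous F}.
  by move=> u0; apply/differentiable_continuous/derivable1_diffP; have [] := dF u u0.
rewrite (@continuous_FTC2 R (sing q) F e 1 e1).
- rewrite -EFinB lee_fin /F ln1 mulr0 expR0 mul1r gerBl.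
  by rewrite divr_ge0 ?expR_ge0// subr_ge0 ltW.
- apply: continuous_in_subspaceT => u; rewrite inE/= in_itv/= => /andP[eu _].
  exact: continuous_sing (pos u eu).
- split.
  + move=> u; rewrite in_itv/= => /andP[/ltW/pos u0 _]; by have [] := dF u u0.
  + by apply: cvg_at_right_filter; exact: cF.
  + by apply: cvg_at_left_filter; exact: cF.
- move=> u; rewrite in_itv/= => /andP[/ltW/pos u0 _].
  by rewrite derive1E; have [] := dF u u0.
Qed.

(** Monotone convergence: integrability of a nonnegative function from a
    uniform bound on sets that exhaust its support. *)
Lemma ge0_integrable_exhaust (f : R -> R) (F : (set R)^nat) (M : R) :
  measurable_fun [set: R] f -> (forall x, 0 <= f x) ->
  nondecreasing_seq F -> (forall n, measurable (F n)) ->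
  (forall n, \int[leb]_(x in F n) (f x)%:E <= M%:E)%E ->
  (forall x, ~ (\bigcup_n F n) x -> f x = 0) ->
  leb.-integrable setT (EFin \o f).
Proof.
move=> mf f0 ndF mF FM fF; apply/integrableP; split; first exact/measurable_EFinP.
under eq_integral do rewrite /= ger0_norm//.
have -> : (\int[leb]_x (f x)%:E = \int[leb]_(x in \bigcup_n F n) (f x)%:E)%E.
  rewrite [RHS]integral_mkcond; apply: eq_integral => x _; rewrite patchE.
  by case: ifPn => // /negP; rewrite inE => /fF ->.
apply: (@le_lt_trans _ _ M%:E); last exact: ltry.
have cv := @ge0_nondecreasing_set_cvg_integral _ (measurableTypeR R) R F (EFin \o f) leb ndF mF.
have {}cv := cv (fun n => measurable_funTS (proj2 (measurable_EFinP _ _) mf)).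
have {}cv : (\int[leb]_(x in F n) (f x)%:E)%E @[n --> \oo] -->
    (\int[leb]_(x in \bigcup_n F n) (f x)%:E)%E.
  by apply: cv => n x _; rewrite lee_fin.
rewrite -(cvg_lim _ cv)//; apply: lime_le.
  by apply/cvg_ex; eexists; exact: cv.
exact: nearW.
Qed.

Let invS n : 0 < (n.+2%:R^-1 : R) < 1.
Proof. by rewrite invr_gt0 ltr0Sn invf_lt1 ?ltr0Sn// ltr1n. Qed.

Let nd_invS : {homo (fun n : nat => n.+2%:R^-1 : R) : m n / (m <= n)%N >-> n <= m}.
Proof. by move=> m n mn; rewrite lef_pV2 ?posrE ?ltr0Sn// ler_nat. Qed.

Lemma exists_invS u : 0 < u -> exists n : nat, n.+2%:R^-1 <= u.
Proof.
move=> u0; exists `|Num.ceil u^-1|%N.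
rewrite -[leRHS]invrK lef_pV2 ?posrE ?ltr0Sn ?invr_gt0//.
rewrite (le_trans (ceil_ge _))//.
have : `|Num.ceil u^-1|%N%:R <= `|Num.ceil u^-1|.+2%:R :> R.
  by rewrite ler_nat -addn2 leq_addr.
apply: le_trans; rewrite natr_absz ger0_norm// ceil_ge0.
by rewrite (lt_trans (ltrN10 _))// invr_gt0.
Qed.

(** The two half-neighbourhoods of 0 are treated together, with b as the sign;
    the sets away from 0 that exhaust them are [1 / (n + 2), 1] and its
    mirror image. *)
Lemma integrable_sing_side q (b : bool) : 0 <= q < 1 ->
  leb.-integrable setT
    (EFin \o (fun x => if 0 < (-1) ^+ b * x <= 1 then sing q x else 0)).
Proof.
move=> q01.
pose F (n : nat) : set R :=
  if b then `[- 1, - n.+2%:R^-1]%classic else `[n.+2%:R^-1, 1]%classic.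
have FE n x : F n x = (n.+2%:R^-1 <= (-1) ^+ b * x <= 1).
  rewrite /F; case: ifP => _; rewrite /= in_itv/= ?expr1 ?expr0 ?mul1r// mulN1r.
  by rewrite lerNr andbC lerNl.
apply: (@ge0_integrable_exhaust _ F (1 - q)^-1).
- apply: measurable_fun_ifT; last exact: measurable_cst.
    apply: measurable_and.
      by apply: measurable_fun_ltr; [exact: measurable_cst|exact: mulrl_measurable].
    by apply: measurable_fun_ler; [exact: mulrl_measurable|exact: measurable_cst].
  exact: measurable_sing.
- by move=> x; case: ifP => // _; exact: sing_ge0.
- move=> m n mn; apply/subsetPset => x; rewrite !FE => /andP[h1 ->].
  by rewrite andbT (le_trans _ h1)// nd_invS.
- by move=> n; rewrite /F; case: ifP => _; exact: measurable_itv.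
- move=> n; have e01 := invS n; have /andP[e0 e1] := e01.
  apply: le_trans (integral_sing_le q01 e01).
  have -> : (\int[leb]_(x in F n) (if (0 < (-1) ^+ b * x <= 1)%R then sing q x else 0%R)%:E
     = \int[leb]_(x in F n) (sing q x)%:E)%E.
    apply: eq_integral => x; rewrite inE FE => /andP[h1 ->].
    by rewrite (lt_le_trans e0 h1).
  rewrite /F; case: ifP => // _.
  rewrite integration_by_substitution_oppr ?(ltW e1)//.
    by under eq_integral do rewrite /= singN.
  apply: continuous_in_subspaceT => u; rewrite inE/= in_itv/= => /andP[_ hu].
  have -> : sing q = sing q \o -%R by apply/funext => v; rewrite /= singN.
  apply: continuous_comp; first exact: opp_continuous.
  by apply: continuous_sing; rewrite (lt_le_trans e0)// lerNr.
- move=> x nx; case: ifP => // /andP[x0 x1]; exfalso; apply: nx.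
  by have [n hn] := exists_invS x0; exists n => //; rewrite FE hn.
Qed.

(** Near 0 the decay is at most 1 and sing is integrable; for |x| >= 1 sing is
    at most 1 and the decay is integrable. *)
Lemma integrable_sing_decay q : 0 <= q < 1 ->
  leb.-integrable setT (EFin \o (fun x => sing q x * decay x)).
Proof.
move=> q01; have /andP[q0 q1] := q01.
have i1 := integrable_sing_side false q01.
have i2 := integrable_sing_side true q01.
have i3 := integrableD measurableT (integrableD measurableT i1 i2) (@integrable_decay R).
apply: (le_integrable measurableT _ _ i3).
  apply/measurable_EFinP; apply: measurable_funM; first exact: measurable_sing.
  exact: measurable_decay.
move=> x _; rewrite /= lee_fin expr0 expr1 mul1r mulN1r.
have d0 := decay_ge0 x; have s0 := sing_ge0 q x.
have d1 : decay x <= 1 by rewrite expR_le1 oppr_le0 divr_ge0.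
rewrite ger0_norm ?mulr_ge0// (le_trans _ (ler_norm _))//.
have [x1|x1] := lerP 1 `|x|.
  have : sing q x * decay x <= decay x by rewrite ler_piMl// sing_le1.
  by case: ifP => _; case: ifP => _; lra.
have [->|x0] := eqVneq x 0.
  rewrite oppr0 ltxx/= !add0r /sing normr0 ln0// mulr0 oppr0 expR0 mul1r//.
have : sing q x * decay x <= sing q x by rewrite ler_piMr.
have [xp|xn] := ltP 0 x.
  rewrite (gtr0_norm xp) in x1.
  by rewrite (ltW x1)/=; case: ifP => _; lra.
have {}xn : x < 0 by rewrite lt_neqAle x0.
rewrite (ltr0_norm xn) in x1.
by rewrite oppr_gt0 xn (ltW x1)/=; lra.
Qed.

Lemma integrable_sing_unit q : 0 <= q < 1 ->
  leb.-integrable setT (EFin \o (fun u => if 0 < u < 1 then sing q u else 0)).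
Proof.
move=> q01; apply: (le_integrable measurableT _ _ (integrable_sing_side false q01)).
  apply/measurable_EFinP; apply: measurable_fun_ifT; last exact: measurable_cst.
    apply: measurable_and; apply: measurable_fun_ltr => //; exact: measurable_cst.
  exact: measurable_sing.
move=> u _; rewrite /= lee_fin expr0 mul1r; case: ifP => [/andP[u0 u1]|_].
  by rewrite u0 (ltW u1).
by rewrite normr0.
Qed.

End PowerSingularity.

(** * Densities and joint laws *)

Section Density.
Context (R : realType) (d : measure_display) (T : measurableType d).
Variables (mu : {sigma_finite_measure set T -> \bar R})
          (nu : {finite_measure set T -> \bar R}).
Variable f : T -> R.
Hypothesis mf : measurable_fun [set: T] f.
Hypothesis f0 : forall t, 0 <= f t.
Hypothesis nuE : forall A, measurable A -> nu A = (\int[mu]_(t in A) (f t)%:E)%E.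

(** f is almost everywhere the Radon-Nikodym derivative of nu, for which the
    change of measure is known. *)
Lemma ge0_integral_density (g : T -> \bar R) : measurable_fun [set: T] g ->
  (forall t, 0 <= g t)%E ->
  (\int[nu]_t g t = \int[mu]_t (g t * (f t)%:E))%E.
Proof.
move=> mg g0.
have mEf : measurable_fun [set: T] (EFin \o f) by exact/measurable_EFinP.
have numu : nu `<< mu.
  apply/null_content_dominatesP => A mA muA0; rewrite nuE//.
  rewrite (eq_integral (abse \o (EFin \o f))); last first.
    by move=> t _ /=; rewrite ger0_norm.
  by apply: integral_abs_eq0 => //; exact: measurable_funTS.
have fi : mu.-integrable setT (EFin \o f).
  apply/integrableP; split => //.
  under eq_integral do rewrite /= ger0_norm//.
  by rewrite -nuE// -ge0_fin_numE// fin_num_measure.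
rewrite -(Radon_Nikodym_SigmaFinite.change_of_variables numu g0 measurableT mg).
have RNi := Radon_Nikodym_SigmaFinite.f_integrable numu.
apply: ae_eq_integral => //.
- by apply: emeasurable_funM => //; exact: measurable_int RNi.
- exact: emeasurable_funM.
have : ae_eq mu setT (Radon_Nikodym_SigmaFinite.f nu mu) (EFin \o f).
  apply: integral_ae_eq => //.
  by move=> A _ mA; rewrite -nuE// -(Radon_Nikodym_SigmaFinite.f_integral numu mA).
by apply: filterS => t h tT; rewrite h.
Qed.

End Density.

Section JointDensity.
Context (R : realType) (d : measure_display) (T : measurableType d).
Variable P : probability T R.
Variables U X : {RV P >-> R}.
Variables fU fX : R -> R.
Hypothesis mfU : measurable_fun [set: R] fU.
Hypothesis mfX : measurable_fun [set: R] fX.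
Hypothesis fU0 : forall x, 0 <= fU x.
Hypothesis fX0 : forall x, 0 <= fX x.
Hypothesis U_pdf : has_pdf P U fU.
Hypothesis X_pdf : has_pdf P X fX.
Hypothesis XU : independent P X U.
Local Notation leb := (@lebesgue_measure R).
Local Notation leb2 := (leb \x leb)%E.

Local Notation RT := (measurableTypeR R).

Let mU : measurable_fun [set: T] (U : T -> RT).
Proof. by have := @measurable_funPT _ _ _ _ U. Qed.

Let mX : measurable_fun [set: T] (X : T -> RT).
Proof. by have := @measurable_funPT _ _ _ _ X. Qed.

Let mUX : measurable_fun [set: T] (fun t => (U t, X t) : (RT * RT)%type).
Proof. exact: measurable_fun_pair. Qed.

Let UT : {mfun T >-> RT} :=
  HB.pack (U : T -> RT) (isMeasurableFun.Build _ _ _ _ _ mU).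

Let XT : {mfun T >-> RT} :=
  HB.pack (X : T -> RT) (isMeasurableFun.Build _ _ _ _ _ mX).

Let UX : {mfun T >-> (RT * RT)%type} :=
  HB.pack (fun t => (U t, X t) : (RT * RT)%type)
    (isMeasurableFun.Build _ _ _ _ _ mUX).

(** By independence the joint law is the product of the two laws, since they
    agree on rectangles; Tonelli then lets each density be inserted in turn. *)
Lemma ge0_joint_integral (g : RT * RT -> \bar R) :
  measurable_fun setT g -> (forall z, 0 <= g z)%E ->
  (\int[P]_t g (U t, X t) = \int[leb2]_z (g z * (fU z.1 * fX z.2)%:E))%E.
Proof.
move=> mg g0.
have -> : (\int[P]_t g (U t, X t) = \int[distribution P UX]_z g z)%E.
  by rewrite ge0_integral_distribution.
have lawE A : measurable A ->
    (distribution P UT \x distribution P XT)%E A = distribution P UX A.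
  apply: product_measure_unique => {}A B mA mB.
  transitivity (P (X @^-1` B `&` U @^-1` A)).
    by rewrite /distribution /pushforward setIC; congr (P _); apply/seteqP; split.
  by rewrite XU// muleC.
rewrite (eq_measure_integral (distribution P UT \x distribution P XT)%E); last first.
  by move=> A mA _; apply: esym; exact: lawE.
rewrite fubini_tonelli1//.
rewrite /fubini_F.
have mX' : measurable_fun [set: RT] (EFin \o fX) by exact/measurable_EFinP.
have mU' : measurable_fun [set: RT] (EFin \o fU) by exact/measurable_EFinP.
have mgX : measurable_fun [set: RT * RT] (fun z => g z * (fX z.2)%:E)%E.
  apply: emeasurable_funM => //.
  exact: measurableT_comp mX' measurable_snd.
have gX0 z : (0 <= g z * (fX z.2)%:E)%E by rewrite mule_ge0// lee_fin.
have densX (x : RT) : (\int[distribution P XT]_y g (x, y) =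
    \int[leb]_y (g (x, y) * (fX y)%:E))%E.
  apply: ge0_integral_density => //.
  exact: measurable_fun_pair2.
under eq_integral do rewrite densX.
have mF := measurable_fun_fubini_tonelli_F (m2 := leb) _ mgX gX0.
have := @ge0_integral_density _ _ _ leb (distribution P UT) fU mfU fU0 U_pdf _ mF.
move=> ->; last by move=> x; exact: integral_ge0.
rewrite [RHS]fubini_tonelli1.
- apply: eq_integral => x _; rewrite /fubini_F muleC -ge0_integralZl//=.
  + by apply: eq_integral => y _; rewrite EFinM muleCA.
  + apply: emeasurable_funM => //; exact: measurable_fun_pair2.
  + by rewrite lee_fin.
- apply: emeasurable_funM => //; apply/measurable_EFinP.
  apply: measurable_funM.
    exact: measurableT_comp mfU measurable_fst.
  exact: measurableT_comp mfX measurable_snd.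
- by move=> z; rewrite mule_ge0// lee_fin mulr_ge0.
Qed.

Let wt (z : RT * RT) : R := fU z.1 * fX z.2.

Let wt0 z : 0 <= wt z. Proof. exact: mulr_ge0. Qed.

(** The weight is nonnegative, so the positive part of the weighted function
    is the weighted positive part, and likewise for the negative part. *)
Lemma joint_integral (h : RT * RT -> R) : measurable_fun [set: RT * RT] h ->
  leb2.-integrable setT (EFin \o (fun z => h z * wt z)) ->
  P.-integrable setT (EFin \o (fun t => h (U t, X t))) /\
  \int[P]_t h (U t, X t) = \int[leb2]_z (h z * wt z).
Proof.
move=> mh /integrableP[mhw hwoo].
have mEh : measurable_fun [set: RT * RT] (EFin \o h) by exact/measurable_EFinP.
split.
  apply/integrableP; split.
    apply/measurable_EFinP; exact: (measurableT_comp mh mUX).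
  apply: le_lt_trans hwoo.
  rewrite (ge0_joint_integral (g := abse \o (EFin \o h))); last 2 first.
  - exact: measurableT_comp.
  - by move=> z; exact: abse_ge0.
  rewrite le_eqVlt; apply/orP; left; apply/eqP; apply: eq_integral => z _ /=.
  by rewrite -EFinM normrM (ger0_norm (wt0 z)).
rewrite /Rintegral; congr fine; rewrite [LHS]integralE [RHS]integralE.
congr (_ - _)%E.
- transitivity (\int[P]_t ((EFin \o h)^\+ (U t, X t)))%E.
    by apply: eq_integral => t _; rewrite !funeposE.
  rewrite ge0_joint_integral//; last exact: measurable_funepos.
  apply: eq_integral => z _; rewrite !funeposE /= -!EFin_max -EFinM.
  by rewrite maxr_pMl ?wt0// mul0r.
- transitivity (\int[P]_t ((EFin \o h)^\- (U t, X t)))%E.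
    by apply: eq_integral => t _; rewrite !funenegE.
  rewrite ge0_joint_integral//; last exact: measurable_funeneg.
  apply: eq_integral => z _; rewrite !funenegE /= -!EFin_max -EFinM.
  by rewrite maxr_pMl ?wt0// mul0r mulNr.
Qed.

Lemma joint_expectationC (g : RT * RT -> R[i]) : cmeas g ->
  integrableC leb2 (fun z => (wt z)%:C * g z) ->
  integrableC P (fun t => g (U t, X t)) /\
  expectationC P (fun t => g (U t, X t)) =
  integralC leb2 (fun z => (wt z)%:C * g z).
Proof.
move=> [g1 g2] [i1 i2].
have ReE : (fun z => complex.Re ((wt z)%:C * g z)) =
    (fun z => complex.Re (g z) * wt z).
  by apply/funext => z; rewrite cReR_M mulrC.
have ImE : (fun z => complex.Im ((wt z)%:C * g z)) =
    (fun z => complex.Im (g z) * wt z).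
  by apply/funext => z; rewrite cImR_M mulrC.
have [j1 e1] : P.-integrable setT (EFin \o (fun t => complex.Re (g (U t, X t)))) /\
    \int[P]_t complex.Re (g (U t, X t)) = \int[leb2]_z (complex.Re (g z) * wt z).
  by apply: (joint_integral g1); rewrite -ReE.
have [j2 e2] : P.-integrable setT (EFin \o (fun t => complex.Im (g (U t, X t)))) /\
    \int[P]_t complex.Im (g (U t, X t)) = \int[leb2]_z (complex.Im (g z) * wt z).
  by apply: (joint_integral g2); rewrite -ImE.
split; first by split.
by rewrite /expectationC /integralC e1 e2 ReE ImE.
Qed.

End JointDensity.

(** * Entire dependence on the exponent *)

Section Entire.
Variable R : realType.
Implicit Types (x y t a c : R) (z w s h : R[i]).
Local Notation leb := (@lebesgue_measure R).

Lemma normc_scale_le t z : 0 <= t <= 1 -> normc (t%:C * z) <= normc z.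
Proof.
by move=> /andP[t0 t1]; rewrite normcM normcR ger0_norm// ler_piMl ?normc_ge0.
Qed.

Lemma normc_expC_le z : normc (expC z) <= expR (normc z).
Proof.
by rewrite normc_expC ler_expR (le_trans (ler_norm _))// normc_Re.
Qed.

Lemma normc_expC_sub1_le z : normc (expC z - 1) <= 2 * (normc z * expR (normc z)).
Proof.
have -> : expC z - 1 = expC (1%:C * z) - expC (0%:C * z).
  by rewrite mul1r mul0r expC0.
apply: (@cmean_value R (fun t => expC (t%:C * z)) (fun t => z * expC (t%:C * z))) => t ht.
  apply: cderiv_expC; apply: cderiv_eq (cderivM (cderiv_id t) (cderiv_cst z t)) _.
  by rewrite mul1r mulr0 addr0.
rewrite normcM ler_wpM2l ?normc_ge0// (le_trans (normc_expC_le _))//.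
by rewrite ler_expR normc_scale_le.
Qed.

(** Twice the mean value bound: t |-> e^(t z) - t z has derivative
    z (e^(t z) - 1). *)
Lemma normc_expC_taylor_le z :
  normc (expC z - 1 - z) <= 4 * (normc z ^+ 2 * expR (normc z)).
Proof.
have -> : expC z - 1 - z = (expC (1%:C * z) - 1%:C * z) - (expC (0%:C * z) - 0%:C * z).
  by rewrite mul1r mul0r expC0 subr0 addrAC.
have -> : 4 * (normc z ^+ 2 * expR (normc z)) =
  2 * (normc z * (2 * (normc z * expR (normc z)))) by ring.
apply: (@cmean_value R (fun t => expC (t%:C * z) - t%:C * z)
  (fun t => z * (expC (t%:C * z) - 1))) => t ht.
  have d : cderiv (fun t => t%:C * z) t z.
    apply: cderiv_eq (cderivM (cderiv_id t) (cderiv_cst z t)) _.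
    by rewrite mul1r mulr0 addr0.
  by apply: cderiv_eq (cderivB (cderiv_expC d) d) _; rewrite mulrBr mulr1.
rewrite normcM ler_wpM2l ?normc_ge0// (le_trans (normc_expC_sub1_le _))//.
by rewrite ler_wpM2l// ler_pM ?normc_ge0 ?expR_ge0 ?ler_expR ?normc_scale_le.
Qed.

Lemma cosh_sqr_inv_le x :
  ((expR (pi * x) + expR (- (pi * x))) ^+ 2)^-1 <= expR (- `|x|).
Proof.
have pi2 := pi_ge2 R; have pi0 := pi_gt0 R.
rewrite [leRHS]expRN lef_pV2 ?posrE ?exprn_gt0 ?addr_gt0 ?expR_gt0//.
have h : expR `|x| <= expR (pi * x) + expR (- (pi * x)).
  have [e1 e2] := (expR_gt0 (pi * x), expR_gt0 (- (pi * x))).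
  case: (ler0P x) => hx.
    have : expR (- x) <= expR (- (pi * x)) by rewrite ler_expR; nra.
    lra.
  have : expR x <= expR (pi * x) by rewrite ler_expR; nra.
  lra.
rewrite (le_trans h)// expr2 ler_peMr// ?addr_ge0 ?expR_ge0//.
by rewrite (le_trans _ h)// -(expR0 R) ler_expR.
Qed.

(** Four times cosh^2 (pi x), the denominator in the definition of B(s, a). *)
Definition bker x : R[i] := ((expR (pi * x) + expR (- (pi * x))) ^+ 2)%:C.

Lemma normc_bkerV_le x : normc (bker x)^-1 <= expR (- `|x|).
Proof.
by rewrite normcV normcR ger0_norm ?cosh_sqr_inv_le// exprn_ge0.
Qed.

Lemma cmeas_bkerV : cmeas (fun x : measurableTypeR R => (bker x)^-1).
Proof.
apply: cmeasV; apply: cmeas_R; apply: measurable_funX; apply: measurable_funD.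
  apply: (measurableT_comp (@measurable_expR R)); exact: mulrl_measurable.
apply: (measurableT_comp (@measurable_expR R)); apply: measurable_funN.
exact: mulrl_measurable.
Qed.

Lemma sqr_le_expR y : 0 <= y -> y ^+ 2 <= 2 * expR y.
Proof.
move=> y0; have := @expR_ge1Dxn R y 1 y0.
by rewrite (_ : 2`! = 2)%N// => h; lra.
Qed.

(** The s-derivative of z^s produces factors log z, and e^(|s| |log z|) bounds
    the power; both are absorbed by an exponential of |log z|,
    which grows more slowly than the denominator of B(s, a). *)
Lemma exp_logH_bound c (K : R) : 0 < c -> 0 <= K ->
  exists2 C, 0 < C & forall x, expR (K * normc (logH (c +i* x))) <= C * expR (`|x| / 2).
Proof.
move=> c0 K0; have [C C0 hC] := @log_modulus_bound R K c c K0 c0.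
exists (expR (K * pi) * C); first by rewrite mulr_gt0 ?expR_gt0.
move=> x; have pr : c <= complex.Re (c +i* x) <= c by rewrite /= lexx.
have h := hC _ pr.
rewrite -mulrA (le_trans _ (ler_wpM2l (expR_ge0 _) h))// -expRD ler_expR -mulrDr.
rewrite ler_wpM2l// (le_trans (normc_le_ReIm _))// addrC lerD2r.
exact: atan_bound.
Qed.

Section Differentiation.
Variable c : R.
Hypothesis c0 : 0 < c.
Let L x : R[i] := logH (c +i* x).
Let G s x : R[i] := (bker x)^-1 * expC (s * L x).
Let DG s x : R[i] := (bker x)^-1 * (L x * expC (s * L x)).

Let cmeas_L : cmeas (L : measurableTypeR R -> R[i]).
Proof. by apply: cmeas_logH; apply: cmeas_pair; [exact: measurable_cst|exact: measurable_id]. Qed.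

Let cmeas_expL s : cmeas (fun x : measurableTypeR R => expC (s * L x)).
Proof. by apply: cmeas_expC; apply: cmeasM => //; exact: cmeas_cst. Qed.

Let dominated (f : R -> R[i]) (M K : R) : 0 <= M -> 0 <= K ->
  (forall x, normc (f x) <= M * (expR (K * normc (L x)))) ->
  exists2 C, 0 < C & forall x, normc ((bker x)^-1 * f x) <= M * (C * decay x).
Proof.
move=> M0 K0 hf; have [C C0 hC] := exp_logH_bound c0 K0.
exists C => // x; rewrite normcM.
have -> : M * (C * decay x) = expR (- `|x|) * (M * (C * expR (`|x| / 2))).
  have -> : decay x = expR (- `|x|) * expR (`|x| / 2).
    by rewrite -expRD; congr expR; field.
  ring.
apply: ler_pM; rewrite ?normc_ge0 ?normc_bkerV_le//.
rewrite (le_trans (hf x))// ler_wpM2l//; exact: hC.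
Qed.

Let integrable_dominated (f : R -> R[i]) (M K : R) : 0 <= M -> 0 <= K ->
  cmeas (f : measurableTypeR R -> R[i]) ->
  (forall x, normc (f x) <= M * (expR (K * normc (L x)))) ->
  integrableC leb (fun x => (bker x)^-1 * f x).
Proof.
move=> M0 K0 mf hf; have [C C0 hC] := dominated M0 K0 hf.
apply: (@integrableC_le _ _ _ leb _ (fun x => M * C * decay x)).
- by apply: cmeasM => //; exact: cmeas_bkerV.
- rewrite /comp; under eq_fun do rewrite EFinM.
  exact: integrableZl (@integrable_decay R).
- by move=> x; rewrite -mulrA.
Qed.

Let expL_le s x : normc (expC (s * L x)) <= 1 * expR (normc s * normc (L x)).
Proof. by rewrite mul1r (le_trans (normc_expC_le _))// normcM. Qed.

Let integrable_G s : integrableC leb (G s).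
Proof.
apply: (integrable_dominated ler01 (normc_ge0 s)); first exact: cmeas_expL.
exact: expL_le.
Qed.

Lemma integrable_bker_powH s :
  integrableC leb (fun x => (bker x)^-1 * powH (c +i* x) s).
Proof. exact: integrable_G. Qed.

Let integrable_DG s : integrableC leb (DG s).
Proof.
apply: (@integrable_dominated _ 1 (1 + normc s)) => //.
- by rewrite addr_ge0// normc_ge0.
- by apply: cmeasM; [exact: cmeas_L|exact: cmeas_expL].
move=> x; rewrite mul1r mulrDl mul1r expRD normcM.
apply: ler_pM; rewrite ?normc_ge0//; last by have := expL_le s x; rewrite mul1r.
by rewrite (le_trans _ (expR_ge1Dx _))// lerDr.
Qed.

(* With the bound on e^z - 1 - z at z = h log (c + i x), the difference
   quotient differs from the formal derivative by O(|h|), uniformly for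
   |h| <= 1; |log|^2 is absorbed by 2 e^|log|. *)
Let taylor s : exists2 C, 0 < C & forall h, h != 0 -> normc h <= 1 ->
  normc (h^-1 * (integralC leb (G (s + h)) - integralC leb (G s)) -
         integralC leb (DG s)) <= C * normc h.
Proof.
have K0 : 0 <= normc s + 2 by rewrite addr_ge0 ?normc_ge0.
have [C C0 hC] := exp_logH_bound c0 K0.
pose D := \int[leb]_x (C * decay x).
have iD : leb.-integrable setT (EFin \o (fun x => C * decay x)).
  by rewrite /comp; under eq_fun do rewrite EFinM;
    exact: integrableZl (@integrable_decay R).
have D0 : 0 <= D.
  by apply: Rintegral_ge0 => x _; rewrite mulr_ge0 ?decay_ge0 ?(ltW C0).
exists (2 * (8 * D) + 1); first by rewrite ltr_wpDl// !mulr_ge0.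
move=> h h0 h1.
pose f x := h^-1 * (expC (h * L x) - 1 - h * L x) * expC (s * L x).
have fE : (fun x => h^-1 * (G (s + h) x - G s x) - DG s x) = (fun x => (bker x)^-1 * f x).
  apply/funext => x; rewrite /G /DG /f mulrDl expCD.
  move: (expC (s * L x)) (expC (h * L x)) => e1 e2.
  move: ((bker x)^-1) => b.
  by field.
rewrite -integralCB// -integralC_cZ; last exact: integrableCB.
rewrite -integralCB//; last by apply: integrableC_cZ; exact: integrableCB.
rewrite fE.
have fle x : normc (f x) <= 8 * normc h * expR ((normc s + 2) * normc (L x)).
  have hh : 0 < normc h by exact: normc_gt0.
  rewrite /f !normcM normcV.
  have -> : 8 * normc h * expR ((normc s + 2) * normc (L x)) =
    (normc h)^-1 * (4 * (normc h ^+ 2 * (2 * expR (normc (L x))) * expR (normc (L x)))) *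
     expR (normc s * normc (L x)).
    have -> : (normc s + 2) * normc (L x) = normc (L x) + normc (L x) + normc s * normc (L x) by ring.
    by rewrite !expRD; field; rewrite gt_eqF.
  apply: ler_pM; rewrite ?mulr_ge0 ?invr_ge0 ?normc_ge0//; last first.
    by have := expL_le s x; rewrite mul1r.
  rewrite ler_wpM2l ?invr_ge0 ?normc_ge0//.
  rewrite (le_trans (normc_expC_taylor_le _))// ler_wpM2l//.
  apply: ler_pM; rewrite ?exprn_ge0 ?normc_ge0 ?expR_ge0//.
    rewrite normcM exprMn ler_wpM2l ?exprn_ge0 ?normc_ge0//.
    by apply: sqr_le_expR; exact: normc_ge0.
  by rewrite ler_expR normcM ler_piMl ?normc_ge0.
have M0 : 0 <= 8 * normc h by rewrite mulr_ge0 ?normc_ge0.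
have mf : cmeas (f : measurableTypeR R -> R[i]).
  apply: cmeasM; last exact: cmeas_expL.
  apply: cmeasM; first exact: cmeas_cst.
  apply: cmeasB; last by apply: cmeasM => //; exact: cmeas_cst.
  by apply: cmeasB; [exact: cmeas_expL|exact: cmeas_cst].
have bf x : normc ((bker x)^-1 * f x) <= 8 * normc h * (C * decay x).
  have -> : 8 * normc h * (C * decay x) = expR (- `|x|) * (8 * normc h * (C * expR (`|x| / 2))).
    have -> : decay x = expR (- `|x|) * expR (`|x| / 2).
      by rewrite -expRD; congr expR; field.
    ring.
  rewrite normcM; apply: ler_pM; rewrite ?normc_ge0 ?normc_bkerV_le//.
  rewrite (le_trans (fle x))// ler_wpM2l//; exact: hC.
have iD' : leb.-integrable setT (EFin \o (fun x => 8 * normc h * (C * decay x))).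
  by rewrite /comp; under eq_fun do rewrite EFinM; exact: integrableZl iD.
have mbf : cmeas (fun x : measurableTypeR R => (bker x)^-1 * f x).
  by apply: cmeasM => //; exact: cmeas_bkerV.
rewrite (le_trans (normc_integralC_le mbf iD' bf))//.
rewrite RintegralZl//.
have -> : 2 * (8 * normc h * D) = 2 * (8 * D) * normc h by ring.
by rewrite ler_wpM2r ?normc_ge0// lerDl.
Qed.

Lemma derivable_integral_powH s :
  derivable ((fun s => integralC leb (G s)) : R[i]^o -> R[i]^o) s 1.
Proof.
apply/cvg_ex; exists (integralC leb (DG s)).
have [C C0 hC] := taylor s.
apply/cvgrPdist_le => e e0.
have [e1 e1E] : exists e1 : R, e = e1%:C.
  by exists (complex.Re e); rewrite (RRe_real (gtr0_real e0)).
have {}e0 : 0 < e1 by move: e0; rewrite e1E ltcR.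
pose r := Num.min 1 (e1 / C).
have r0 : 0 < r by rewrite lt_min ltr01 divr_gt0.
exists r%:C; first by rewrite /= ltcR.
move=> h /=; rewrite sub0r normrN => hr h0.
have {}hr : normc h < r by rewrite -ltcR; case: h hr {h0}.
rewrite e1E distrC.
rewrite /= /shift/= [_ *: 1]mulr1 (addrC h s).
suff : normc (h^-1 * (integralC leb (G (s + h)) - integralC leb (G s)) -
         integralC leb (DG s)) <= e1 by rewrite -lecR.
have h1 : normc h <= 1 by rewrite (le_trans (ltW hr))// ge_min lexx.
apply: (le_trans (hC h h0 h1)).
rewrite mulrC -ler_pdivlMr// (le_trans (ltW hr))// ge_min lexx orbT//.
Qed.

End Differentiation.

Lemma gen_bernoulliE s a : 2^-1 < a ->
  gen_bernoulli s a =
  (2 * pi)%:C * integralC leb (fun x => (bker x)^-1 * powH ((a - 2^-1) +i* x) s).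
Proof.
move=> a2; rewrite /gen_bernoulli; congr (_ * integralC leb _).
by apply/funext => x; rewrite mulrC powC_powH //= subr_gt0.
Qed.

Lemma entire_gen_bernoulli a : 1 <= a -> entire (fun s => gen_bernoulli s a).
Proof.
move=> a1 s; have a2 : 2^-1 < a by lra.
have -> : (fun s => gen_bernoulli s a) = (fun s => (2 * pi)%:C *:
  (integralC leb (fun x => (bker x)^-1 * powH ((a - 2^-1) +i* x) s) : R[i]^o)).
  by apply/funext => z; rewrite gen_bernoulliE.
apply: derivableZ; apply: derivable_integral_powH.
by rewrite subr_gt0.
Qed.

End Entire.

(** * The identity for the densities *)

Section Densities.
Variable R : realType.
Implicit Types (x y t u a c r : R) (s : R[i]).
Local Notation leb := (@lebesgue_measure R).
Local Notation RT := (measurableTypeR R).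
Local Notation leb2 := (leb \x leb)%E.

Lemma measurable_pdf_X : measurable_fun [set: R] (@pdf_X R).
Proof.
have [m _] := @cmeas_kerX R _ R (fun x => x%:C) (cmeas_R (@measurable_id _ _ _)).
have -> : @pdf_X R = (fun x => complex.Re (kerX x%:C)).
  by apply/funext => x; rewrite kerXR.
exact: m.
Qed.

(** 2 (y cosh y - sinh y) vanishes at 0 and has derivative
    y (e^y - e^(-y)). *)
Lemma sinh_le_mul_cosh y : 0 <= y -> sinh y <= y * cosh y.
Proof.
move=> y0.
pose m t : R := (t - 1) * expR t + (t + 1) * expR (- t).
have dm t : is_derive t 1 m (t * (expR t - expR (- t))).
  have d2 : is_derive t 1 (fun t => expR (- t)) (- expR (- t)).
    have h := @is_derive1_comp R expR (-%R) t _ _ (is_derive_expR _) (is_deriveNid t 1).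
    by apply: is_derive_eq; ring.
  by apply: is_derive_eq; rewrite /GRing.scale/=; ring.
have cm : {within `[0, y], continuous m}.
  by apply: derivable_within_continuous => t _; have [] := dm t.
have [c] := MVT_segment y0 (fun t _ => dm t) cm.
rewrite in_itv/= => /andP[c0 _] mE.
have : 0 <= m y - m 0.
  rewrite mE subr0 !mulr_ge0// subr_ge0 ler_expR; lra.
rewrite /m oppr0 expR0 /sinh /cosh; lra.
Qed.

Lemma pdf_X_ge0 x : 0 <= pdf_X x.
Proof.
have aux (y : R) : 0 < y -> 0 <= (y * coth y - 1) / sinh y ^+ 2.
  move=> y0; rewrite divr_ge0 ?sqr_ge0// subr_ge0 /coth mulrA.
  have s0 : 0 < sinh y.
    by rewrite /sinh divr_gt0// subr_gt0 ltr_expR; lra.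
  by rewrite ler_pdivlMr// mul1r sinh_le_mul_cosh// ltW.
rewrite /pdf_X -mulrA mulr_ge0 ?pi_ge0//.
have [x0|x0|->] := ltgtP x 0.
- have := aux (- (pi * x)).
  have sN : sinh (- (pi * x)) = - sinh (pi * x) by rewrite /sinh opprK; field.
  have cN : cosh (- (pi * x)) = cosh (pi * x) by rewrite /cosh opprK addrC.
  rewrite /coth sN cN invrN mulrN mulrNN sqrrN; apply.
  by rewrite -mulrN mulr_gt0 ?pi_gt0// oppr_gt0.
- by apply: aux; rewrite mulr_gt0 ?pi_gt0.
- have s0 : sinh (pi * 0) = 0 :> R by rewrite /sinh mulr0 oppr0 subrr mul0r.
  by rewrite s0 expr0n invr0 mulr0.
Qed.

Lemma pdf_X_le : exists2 C : R, 0 < C & forall x, pdf_X x <= C * expR (- `|x|).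
Proof.
have [C C0 hC] := @normc_kerX_le R; exists C => // x.
have := hC x%:C; rewrite kerXR normcR /= normr0 invr_ge0 ler0n => /(_ isT).
by rewrite ger0_norm// pdf_X_ge0.
Qed.

Lemma pdf_X0 : pdf_X 0 = 0 :> R.
Proof.
have s0 : sinh (pi * 0) = 0 :> R by rewrite /sinh mulr0 oppr0 subrr mul0r.
by rewrite /pdf_X s0 expr0n invr0 mulr0.
Qed.

Let measurable_unit : measurable_fun [set: R] (fun u : R => 0 < u < 1).
Proof.
apply: measurable_and; apply: measurable_fun_ltr => //; exact: measurable_cst.
Qed.

Lemma measurable_pdf_U1 : measurable_fun [set: R] (@pdf_U1 R).
Proof. by apply: measurable_fun_ifT => //; exact: measurable_cst. Qed.

Lemma measurable_pdf_U2 : measurable_fun [set: R] (@pdf_U2 R).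
Proof.
apply: measurable_fun_ifT => //.
apply: measurable_funM => //.
by apply: measurable_funB; [exact: measurable_cst|exact: measurable_id].
Qed.

Lemma pdf_U1_bound u : 0 <= pdf_U1 u <= if 0 < u < 1 then 2 else 0.
Proof. by rewrite /pdf_U1; case: ifP => _; rewrite ?lexx// ler01 ler1n. Qed.

Lemma pdf_U2_bound u : 0 <= pdf_U2 u <= if 0 < u < 1 then 2 else 0.
Proof.
rewrite /pdf_U2; case: ifP => [/andP[u0 u1]|_]; last by rewrite lexx.
by apply/andP; split; lra.
Qed.

Lemma integrable_prod (f g : R -> R) : (forall x, 0 <= f x) -> (forall x, 0 <= g x) ->
  leb.-integrable setT (EFin \o f) -> leb.-integrable setT (EFin \o g) ->
  leb2.-integrable setT (EFin \o (fun z => f z.1 * g z.2)).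
Proof.
move=> f0 g0 fi gi.
have mf : measurable_fun [set: RT] f by apply/measurable_EFinP; exact: measurable_int fi.
have mg : measurable_fun [set: RT] g by apply/measurable_EFinP; exact: measurable_int gi.
apply/integrable12ltyP.
  apply/measurable_EFinP; apply: measurable_funM.
    exact: measurableT_comp mf measurable_fst.
  exact: measurableT_comp mg measurable_snd.
have E : (\int[leb]_x \int[leb]_y `|(f x * g y)%:E| =
    \int[leb]_x ((f x)%:E * \int[leb]_y (g y)%:E))%E.
  apply: eq_integral => x _.
  rewrite -ge0_integralZl//; last 3 first.
  - exact/measurable_EFinP.
  - by move=> y _; rewrite lee_fin.
  - by rewrite lee_fin.
  by apply: eq_integral => y _; rewrite /= ger0_norm ?mulr_ge0.
rewrite /= E.
have gfin : (\int[leb]_y (g y)%:E)%E \is a fin_num by exact: integrable_fin_num gi.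
rewrite -(fineK gfin) ge0_integralZr//; last 3 first.
- exact/measurable_EFinP.
- by move=> y _; rewrite lee_fin.
- by rewrite fineK//; apply: integral_ge0 => y _; rewrite lee_fin.
have ffin : (\int[leb]_y (f y)%:E)%E \is a fin_num by exact: integrable_fin_num fi.
by rewrite -(fineK ffin) -EFinM ltry.
Qed.

Lemma cmeas_base a s :
  cmeas (fun z : RT * RT => powC ((a + z.1) +i* z.2) s).
Proof.
apply: cmeas_powC; apply: cmeas_pair.
  apply: measurable_funD; first exact: measurable_cst.
  exact: measurable_fst.
exact: measurable_snd.
Qed.

(** The exponential decay of the density of X beats the growth of the power,
    and the singularity at u = x = 0 splits into a product. *)
Lemma integrable_weighted_powC a s (p : R -> R) : 1 <= a ->
  1 < a \/ -1 < complex.Re s -> measurable_fun [set: R] p ->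
  (forall u, 0 <= p u <= if 0 < u < 1 then 2 else 0) ->
  integrableC leb2 (fun z =>
    (p z.1 * pdf_X z.2)%:C * powC ((a - 1 + z.1) +i* z.2) (s - 1)).
Proof.
move=> a1 hD mp pb.
have [q [C [q01 C0 hC]]] := powH_singularity_bound a1 hD.
have [C' C'0 hC'] := pdf_X_le.
pose f u : R := 2 * C * C' * (if 0 < u < 1 then sing q u else 0).
pose g x : R := sing q x * decay x.
have i1 : leb.-integrable setT (EFin \o f).
  by rewrite /comp; under eq_fun do rewrite EFinM;
    exact: integrableZl (integrable_sing_unit q01).
have i2 : leb.-integrable setT (EFin \o g) := integrable_sing_decay q01.
have b1 u : 0 <= f u.
  by rewrite /f !mulr_ge0 ?(ltW C0) ?(ltW C'0)//; case: ifP => // _; exact: sing_ge0.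
have b2 x : 0 <= g x.
  by rewrite /g; apply: mulr_ge0; [exact: sing_ge0|exact: decay_ge0].
have i12 := @integrable_prod f g b1 b2 i1 i2.
apply: (@integrableC_le _ _ _ leb2 _ (fun z => f z.1 * g z.2) _ i12).
  apply: cmeasM; last exact: cmeas_base.
  apply: cmeas_R; apply: measurable_funM.
    exact: measurableT_comp mp measurable_fst.
  exact: measurableT_comp measurable_pdf_X measurable_snd.
suff main u x : normc ((p u * pdf_X x)%:C * powC ((a - 1 + u) +i* x) (s - 1)) <=
    f u * g x by case=> u x; exact: main.
rewrite normcM normcR /f /g.
have /andP[p0 p2] := pb u.
have px0 := pdf_X_ge0 x.
rewrite ger0_norm; last exact: mulr_ge0.
case: ifP p2 => [u01 p2|_ p2]; last first.
  have -> : p u = 0 by apply/eqP; rewrite eq_le p2.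
  by rewrite mulr0 !mul0r.
have [->|x0] := eqVneq x 0.
  rewrite pdf_X0 mulr0 mul0r; apply: mulr_ge0; last exact: (b2 0).
  by rewrite !mulr_ge0 ?(ltW C0) ?(ltW C'0)//; exact: sing_ge0.
rewrite powC_powH; last by rewrite /=; case/andP: u01 => ? _; lra.
have -> : 2 * C * C' * sing q u * (sing q x * decay x) =
    2 * (C' * expR (- `|x|)) * (C * (sing q u * sing q x) * expR (`|x| / 2)).
  have -> : decay x = expR (- `|x|) * expR (`|x| / 2).
    by rewrite -expRD; congr expR; field.
  ring.
apply: ler_pM; [exact: mulr_ge0|exact: normc_ge0| |exact: hC].
by apply: ler_pM.
Qed.

Lemma integrable_kerX_powH c r s : 0 < c -> `|r| <= 2^-1 ->
  integrableC leb (fun y => kerX (y +i* r) * powH (c +i* y) s).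
Proof.
move=> c0 hr.
have [C C0 hC] := @normc_kerX_le R.
have [C' C'0 hC'] := @normc_powH_bound R s c c c0.
apply: (@integrableC_le _ _ _ leb _ (fun y => C * C' * decay y)).
- apply: cmeasM.
    by apply: cmeas_kerX; apply: cmeas_pair => //; exact: measurable_cst.
  by apply: cmeas_powH; apply: cmeas_pair => //; exact: measurable_cst.
- by rewrite /comp; under eq_fun do rewrite EFinM;
    exact: integrableZl (@integrable_decay R).
move=> y; rewrite normcM.
have -> : decay y = expR (- `|y|) * expR (`|y| / 2).
  by rewrite -expRD; congr expR; field.
rewrite mulrACA; apply: ler_pM; rewrite ?normc_ge0//; first exact: (hC (y +i* r)).
by apply: (hC' (c +i* y)); rewrite /= lexx.
Qed.

(* the sum of the densities of U1 and U2 with weights a - 1 and 1/2 *)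
Let wgt a u : R := if 0 < u < 1 then a - u else 0.

Let measurable_wgt a : measurable_fun [set: R] (wgt a).
Proof.
apply: measurable_fun_ifT => //.
by apply: measurable_funB; [exact: measurable_cst|exact: measurable_id].
Qed.

Let integrable_unit (M : R) :
  leb.-integrable setT (EFin \o (fun u => if 0 < u < 1 then M else 0)).
Proof.
have q0 : 0 <= (0 : R) < 1 by rewrite lexx ltr01.
have h := integrableZl measurableT M (integrable_sing_unit q0).
apply: eq_integrable h => // u _ /=.
by rewrite -EFinM; case: ifP => _; rewrite ?sing0 ?mulr1 ?mulr0.
Qed.

Let wgt_le a u : 1 <= a -> `|wgt a u| <= if 0 < u < 1 then a else 0.
Proof.
move=> a1; rewrite /wgt; case: ifP => [/andP[u0 u1]|_]; last by rewrite normr0.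
by rewrite ger0_norm; lra.
Qed.

(** Shift the contour for each u, exchange the integrals, and evaluate the
    integral over u.  After the shift the base of the power is on Re = a - 1/2 > 0,
    away from 0, and the integrand is dominated by a decaying function of y
    alone. *)
Lemma weighted_shift_integral a s : 1 <= a ->
  1 < a \/ -1 < complex.Re s ->
  integrableC leb2 (fun z =>
    (wgt a z.1 * pdf_X z.2)%:C * powC ((a - 1 + z.1) +i* z.2) (s - 1)) ->
  integralC leb2 (fun z =>
    (wgt a z.1 * pdf_X z.2)%:C * powC ((a - 1 + z.1) +i* z.2) (s - 1)) =
  gen_bernoulli s a.
Proof.
move=> a1 hD iZ.
pose c := a - 2^-1; have c0 : 0 < c by rewrite /c; lra.
pose K (z : RT * RT) : R[i] := (wgt a z.1)%:C *
  (kerX (z.2 +i* (z.1 - 2^-1)) * powH (c +i* z.2) (s - 1)).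
have sub_half : measurable_fun [set: RT] (fun u : RT => u - 2^-1).
  by apply: measurable_funB; [exact: measurable_id|exact: measurable_cst].
have half_le u : 0 < u < 1 -> `|u - 2^-1| <= 2^-1.
  by move=> /andP[? ?]; rewrite ler_norml; apply/andP; split; lra.
have [Ck Ck0 hk] := @normc_kerX_le R.
have [Cp Cp0 hp] := @normc_powH_bound R (s - 1) c c c0.
(* K is the integrand after the shift *)
have iK : integrableC leb2 K.
  pose f u : R := if 0 < u < 1 then a else 0.
  pose g y : R := Ck * Cp * decay y.
  have b1 u : 0 <= f u by rewrite /f; case: ifP => // _; lra.
  have b2 y : 0 <= g y.
    by rewrite /g !mulr_ge0 ?decay_ge0 ?(ltW Ck0) ?(ltW Cp0).
  have i2 : leb.-integrable setT (EFin \o g).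
    by rewrite /comp; under eq_fun do rewrite EFinM;
      exact: integrableZl (@integrable_decay R).
  have i12 := @integrable_prod f g b1 b2 (integrable_unit a) i2.
  apply: (@integrableC_le _ _ _ leb2 _ (fun z => f z.1 * g z.2) _ i12).
    apply: cmeasM.
      by apply: cmeas_R; exact: measurableT_comp (measurable_wgt a) measurable_fst.
    apply: cmeasM.
      apply: cmeas_kerX; apply: cmeas_pair; first exact: measurable_snd.
      exact: measurableT_comp sub_half measurable_fst.
    apply: cmeas_powH; apply: cmeas_pair; first exact: measurable_cst.
    exact: measurable_snd.
  suff main u y : normc ((wgt a u)%:C *
      (kerX (y +i* (u - 2^-1)) * powH (c +i* y) (s - 1))) <= f u * g y.
    by case=> u y; exact: main.
  rewrite normcM normcR /f /g.
  have := wgt_le u a1; rewrite /wgt; case: ifP => [u01|_ _]; last by rewrite normr0 !mul0r.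
  move=> hw; apply: ler_pM; rewrite ?normc_ge0// normcM.
  have -> : decay y = expR (- `|y|) * expR (`|y| / 2).
    by rewrite -expRD; congr expR; field.
  rewrite mulrACA; apply: ler_pM; rewrite ?normc_ge0//.
    by apply: (hk (y +i* (u - 2^-1))); exact: half_le.
  by apply: (hp (c +i* y)); rewrite /= lexx.
rewrite -(integralC_fubini1 iZ).
transitivity (integralC leb (fun u => integralC leb (fun y => K (u, y)))).
  congr (integralC leb _); apply/funext => u; rewrite /K /=.
  rewrite /wgt; case: ifP => [u01|_]; last first.
    by congr (integralC leb _); apply/funext => x; rewrite !mul0r.
  have /andP[u0 u1] := u01.
  have au0 : 0 < a - 1 + u by lra.
  transitivity ((a - u)%:C * integralC leb
      (fun x => kerX (x +i* 0) * powH ((a - 1 + u) +i* x) (s - 1))).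
    rewrite -integralC_cZ; last first.
      by apply: integrable_kerX_powH => //; rewrite normr0.
    congr (integralC leb _); apply/funext => x.
    have -> : ((a - u) * pdf_X x)%:C = (a - u)%:C * kerX (x +i* 0).
      by rewrite [kerX _]kerXR rmorphM.
    by rewrite powC_powH// -mulrA.
  rewrite integralC_cZ; last exact: integrable_kerX_powH c0 (half_le _ u01).
  congr (_ * _).
  have -> : a - 1 + u = c + (u - 2^-1) by rewrite /c; field.
  apply: kernel_shift => //; last by rewrite /c; lra.
  by rewrite ltr_norml; apply/andP; split; lra.
rewrite (integralC_fubini1 iK) -(integralC_fubini2 iK) gen_bernoulliE; last by lra.
rewrite -/c -integralC_cZ; last exact: integrable_bker_powH.
apply: ae_eq_integralC.
- exact: cmeas_fubini2 iK.
- apply: cmeasM; first exact: cmeas_cst.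
  exact: integrableC_cmeas (integrable_bker_powH c0 s).
have : leb.-negligible [set 0 : R].
  by apply/negligibleP => //; exact: lebesgue_measure_set1.
apply: negligibleS => y /=; apply: contra_notP => /eqP y0.
rewrite /K /=.
transitivity (powH (c +i* y) (s - 1) * integralC leb (fun u =>
   (wgt a u)%:C * kerX (y +i* (u - 2^-1)))).
  rewrite -integralC_cZ.
    by congr (integralC leb _); apply/funext => u; rewrite mulrA mulrC.
  have iu : leb.-integrable setT (EFin \o (fun u => Ck * (if 0 < u < 1 then a else 0))).
    by rewrite /comp; under eq_fun do rewrite EFinM;
      exact: integrableZl (integrable_unit a).
  apply: (@integrableC_le _ _ _ leb _ (fun u => Ck * (if 0 < u < 1 then a else 0)) _ iu).
    apply: cmeasM; first by apply: cmeas_R; exact: measurable_wgt.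
    by apply: cmeas_kerX; apply: cmeas_pair => //; exact: measurable_cst.
  move=> u; rewrite normcM normcR mulrC.
  have := wgt_le u a1; rewrite /wgt; case: ifP => [u01|_ _]; last by rewrite normr0 !mulr0.
  move=> hw; apply: ler_pM; rewrite ?normc_ge0//.
  have := hk (y +i* (u - 2^-1)) (half_le _ u01); move/le_trans; apply.
  by rewrite ler_piMr ?(ltW Ck0)// expR_le1 oppr_le0.
rewrite inner_integral// -/c.
rewrite -(powH_mul s (_ : 0 < complex.Re (c +i* y)))//.
have c1 : ccosh (pi%:C * y%:C) != 0.
  rewrite -rmorphM ccoshR (fmorph_eq0 (real_complex R)) gt_eqF//.
  by apply: lt_le_trans (cosh_ge _); rewrite divr_gt0 ?expR_gt0.
have -> : bker y = 4%:R * ccosh (pi%:C * y%:C) ^+ 2.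
  rewrite -rmorphM ccoshR /bker /cosh -rmorphXn natC -rmorphM; congr (_%:C).
  by field.
have -> : (2^-1 * pi)%:C = 2%:R^-1 * pi%:C :> R[i].
  by rewrite rmorphM fmorphV (rmorph_nat (real_complex R)).
have -> : (2 * pi)%:C = 2%:R * pi%:C :> R[i].
  by rewrite rmorphM (rmorph_nat (real_complex R)).
move: (powH _ _) => p; move: c1; move: (ccosh _) (c +i* y) => ch w c1.
by field; rewrite c1 ?pnatr_eq0.
Qed.

Lemma mixture_weight a u : 2^-1 * pdf_U2 u + (a - 1) * pdf_U1 u = wgt a u.
Proof. by rewrite /pdf_U2 /pdf_U1 /wgt; case: ifP => _; field. Qed.

Lemma mixture_integral a s (a1 : 1 <= a) (hD : 1 < a \/ -1 < complex.Re s) :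
  2^-1 * integralC leb2 (fun z =>
    (pdf_U2 z.1 * pdf_X z.2)%:C * powC ((a - 1 + z.1) +i* z.2) (s - 1)) +
  (a - 1)%:C * integralC leb2 (fun z =>
    (pdf_U1 z.1 * pdf_X z.2)%:C * powC ((a - 1 + z.1) +i* z.2) (s - 1)) =
  gen_bernoulli s a.
Proof.
have i1 := integrable_weighted_powC a1 hD measurable_pdf_U1 pdf_U1_bound.
have i2 := integrable_weighted_powC a1 hD measurable_pdf_U2 pdf_U2_bound.
have j1 := integrableC_cZ (a - 1)%:C i1.
have j2 := integrableC_cZ 2^-1 i2.
have E : (fun z : RT * RT =>
    (wgt a z.1 * pdf_X z.2)%:C * powC ((a - 1 + z.1) +i* z.2) (s - 1)) =
  (fun z => 2^-1 * ((pdf_U2 z.1 * pdf_X z.2)%:C * powC ((a - 1 + z.1) +i* z.2) (s - 1)) +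
    (a - 1)%:C * ((pdf_U1 z.1 * pdf_X z.2)%:C * powC ((a - 1 + z.1) +i* z.2) (s - 1))).
  apply/funext => z; rewrite -mixture_weight.
  have e2 : (2^-1 : R[i]) = (2^-1)%:C.
    by rewrite fmorphV (rmorph_nat (real_complex R)).
  by rewrite e2 !rmorphM rmorphD !rmorphM; ring.
have iE : integrableC leb2 (fun z : RT * RT =>
    (wgt a z.1 * pdf_X z.2)%:C * powC ((a - 1 + z.1) +i* z.2) (s - 1)).
  by rewrite E; exact: integrableCD.
by rewrite -(weighted_shift_integral a1 hD iE) E integralCD// !integralC_cZ.
Qed.

End Densities.

(** * The integral representation *)

(* U1 + iX and U2 + iX have a positive bounded density near 0, so for a = 1 the
   expectations converge exactly when -1 < Re s; for 1 < a they converge for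
   every s.  The second summand is (a - 1) E[(a - 1 + U1 + iX)^(s-1)]: without
   the shift a - 1 the identity already fails at s = 2, a = 2. *)
Theorem corollary2p2 (R : realType)
    (d : measure_display) (T : measurableType d) (P : probability T R)
    (U1 U2 X : {RV P >-> R})
    (d' : measure_display) (T' : measurableType d') (P' : probability T' R)
    (S2 : {RV P' >-> R})
    (U1_pdf : has_pdf P U1 (@pdf_U1 R))
    (U2_pdf : has_pdf P U2 (@pdf_U2 R))
    (S2_charfun : forall theta : R, charfun P' S2 theta = (charfun_S2 theta)%:C)
    (X_S2 : eq_in_distribution P P' X (fun t => S2 t / 2))
    (X_pdf : has_pdf P X (@pdf_X R))
    (X_U1 : independent P X U1)
    (X_U2 : independent P X U2) :
  (forall a : R, 1 <= a ->
    let Z1 s t := powC ((a - 1 + U1 t) +i* X t) (s - 1) in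
    let Z2 s t := powC ((a - 1 + U2 t) +i* X t) (s - 1) in
    let D := [set s : R[i] | 1 < a \/ -1 < complex.Re s] in
    (forall s, D s -> integrableC P (Z1 s) /\ integrableC P (Z2 s)) /\
    entire_continuation D
      (fun s => 2^-1 * expectationC P (Z2 s)
                + (a - 1)%:C * expectationC P (Z1 s))
      (fun s => gen_bernoulli s a)) /\
  (let Z s t := powC (U2 t +i* X t) (s - 1) in
   let D := [set s : R[i] | -1 < complex.Re s] in
   (forall s, D s -> integrableC P (Z s)) /\
   entire_continuation D
     (fun s => 2^-1 * expectationC P (Z s))
     (@bernoulli R)).
Proof.
have pU1_ge0 u : 0 <= pdf_U1 u :> R by have /andP[] := pdf_U1_bound u.
have pU2_ge0 u : 0 <= pdf_U2 u :> R by have /andP[] := pdf_U2_bound u.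
have core (a : R) (s : R[i]) : 1 <= a -> 1 < a \/ -1 < complex.Re s ->
    [/\ integrableC P (fun t => powC ((a - 1 + U1 t) +i* X t) (s - 1)),
        integrableC P (fun t => powC ((a - 1 + U2 t) +i* X t) (s - 1)) &
        gen_bernoulli s a =
        2^-1 * expectationC P (fun t => powC ((a - 1 + U2 t) +i* X t) (s - 1)) +
        (a - 1)%:C *
          expectationC P (fun t => powC ((a - 1 + U1 t) +i* X t) (s - 1))].
  move=> a1 hs.
  have [i1 e1] := joint_expectationC (@measurable_pdf_U1 R) (@measurable_pdf_X R)
    pU1_ge0 (@pdf_X_ge0 R) U1_pdf X_pdf X_U1 (cmeas_base (a - 1) (s - 1))
    (integrable_weighted_powC a1 hs (@measurable_pdf_U1 R) (@pdf_U1_bound R)).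
  have [i2 e2] := joint_expectationC (@measurable_pdf_U2 R) (@measurable_pdf_X R)
    pU2_ge0 (@pdf_X_ge0 R) U2_pdf X_pdf X_U2 (cmeas_base (a - 1) (s - 1))
    (integrable_weighted_powC a1 hs (@measurable_pdf_U2 R) (@pdf_U2_bound R)).
  by split => //; rewrite [X in _ * X + _]e2 [X in _ + _ * X]e1 mixture_integral.
split.
  move=> a a1 Z1 Z2 D; split.
    by move=> s /(core a s a1)[].
  split; first exact: entire_gen_bernoulli.
  by move=> s /(core a s a1)[].
move=> Z D.
have ZE s : Z s = (fun t => powC ((1 - 1 + U2 t) +i* X t) (s - 1)).
  by apply/funext => t; rewrite subrr add0r.
have core1 s : D s -> 1 < (1 : R) \/ -1 < complex.Re s by right.
split; first by move=> s /core1 /(core 1 s (lexx _))[_ + _]; rewrite ZE.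
split; first exact: (@entire_gen_bernoulli R 1 (lexx _)).
move=> s /core1 /(core 1 s (lexx _))[_ _]; rewrite /bernoulli ZE => ->.
by rewrite subrr rmorph0 mul0r addr0.
Qed.
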